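(* Let $G$ be a compact, connected Lie group with maximal torus $T$ and Weyl group $W=N_G(T)/T$, and let $T$ act on $G/T$ by left multiplication. View $W$ as a subset of $G/T$; it is the fixed point set of the action. For a fixed point $w\in W$, let $$i_w^*\colon H_T^*(G/T)\to H_T^*(\{w\})=H^*(BT)=\mathbb{Q}[u_1,\dots,u_\ell]$$ be the restriction map in equivariant cohomology induced by the inclusion $i_w\colon\{w\}\hookrightarrow G/T$. Then: (i) $i_w^*u_i=u_i$ for each $i$. (ii) For any character $\gamma\in\hat T$, $i_w^*c_1^T(L_\gamma)=w\cdot c_1(S_\gamma)$. In particular, if $\tilde y_i=c_1^T(L_{\chi_i})$ and $u_i=c_1(S_{\chi_i})$, then $i_w^*\tilde y_i=w\cdot u_i$.
   Context: Cohomology is singular with rational coefficients. $\hat T$ is the group of characters $\gamma\colon T\to\mathbb{C}^*$, written additively, with basis $\chi_1,\dots,\chi_\ell$; $\mathbb{C}_\gamma$ is $\mathbb{C}$ with $T$ acting through $\gamma$. For a principal $T$-bundle $X\to X/T$ (right action), $L(X/T,\gamma)=X\times_T\mathbb{C}_\gamma=(X\times\mathbb{C}_\gamma)/T$, where $(x,v)t=(xt,\gamma(t^{-1})v)$. Put $L_\gamma=L(G/T,\gamma)$ on $G/T$ and $S_\gamma=L(BT,\gamma)$ on $BT=ET/T$, where $ET=EG$. Let $u_i=c_1(S_{\chi_i})\in H^2(BT)$, so $H^*(BT)=\mathbb{Q}[u_1,\dots,u_\ell]$. For a $T$-space $M$, $M_T=(ET\times M)/T$ with $(e,x)t=(et,t^{-1}x)$,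 and $H_T^*(M)=H^*(M_T)$; it is an $H^*(BT)$-algebra by pullback along $M\to\mathrm{pt}$, and $u_i\in H_T^*(M)$ denotes the pullback of $u_i\in H_T^*(\mathrm{pt})=H^*(BT)$. The bundle $L_\gamma$ is $T$-equivariant via $t\cdot[g,v]=[tg,v]$, and $c_1^T(L_\gamma)=c_1((L_\gamma)_T)\in H_T^2(G/T)$ with $(L_\gamma)_T$ the induced bundle over $(G/T)_T$. $W$ acts on $\hat T$ by $(w\cdot\gamma)(t)=\gamma(w^{-1}tw)$, and on $H^*(BT)=H^*(EG/T)$ by ring isomorphisms $w\cdot a=r_w^*a$, where $r_w(eT)=ewT$. *)

(* Defs.v *)
From HB Require Import structures.
From mathcomp Require Import all_boot all_order all_algebra.
From mathcomp Require Import generic_quotient ring_quotient.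
From mathcomp Require Import all_classical all_reals all_analysis.
From mathcomp.real_closed Require Import complex.

Set Implicit Arguments.
Unset Strict Implicit.
Unset Printing Implicit Defensive.

Import Order.TTheory GRing.Theory Num.Theory.
Import numFieldNormedType.Exports.

Local Open Scope classical_set_scope.
Local Open Scope quotient_scope.
Local Open Scope ring_scope.

(* The complex numbers with their usual topology: [^o] gives the field [R[i]]
   the normed-space structure defined by its own modulus. *)
Notation cplx R := ((R[i])^o) (only parsing).

Section ContinuityTools.

Lemma pair_cts (X Y Z : topologicalType) (f : X -> Y) (g : X -> Z) :
  continuous f -> continuous g -> continuous (fun x => (f x, g x)).
Proof. by move=> cf cg x; apply: cvg_pair; [exact: cf|exact: cg]. Qed.

Lemma fst_cts (Y Z : topologicalType) : continuous (fun p : Y * Z => p.1).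
Proof. by move=> p; exact: cvg_fst. Qed.

Lemma snd_cts (Y Z : topologicalType) : continuous (fun p : Y * Z => p.2).
Proof. by move=> p; exact: cvg_snd. Qed.

Lemma comp_cts (X Y Z : topologicalType) (g : Y -> Z) (f : X -> Y) :
  continuous g -> continuous f -> continuous (fun x => g (f x)).
Proof. by move=> cg cf x; apply: continuous_comp; [exact: cf|exact: cg]. Qed.

Lemma id_cts (X : topologicalType) : continuous (fun x : X => x).
Proof. by move=> x; exact: cvg_id. Qed.

Lemma cst_cts (X Y : topologicalType) (y : Y) : continuous (fun _ : X => y).
Proof. by move=> x; exact: cvg_cst. Qed.

Lemma set_val_cts (X : topologicalType) (A : set X) :
  continuous (fun x : A => set_val x).
Proof. exact: initial_continuous. Qed.

Lemma to_set_type_cts (X Y : topologicalType) (A : set Y) (f : X -> A) :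
  continuous (fun x => set_val (f x)) -> continuous f.
Proof.
move=> cf; apply/continuousP => _ [U oU <-].
by move/continuousP: cf => /(_ U oU).
Qed.

End ContinuityTools.

HB.mixin Record isTopGroup G of Group G & Topological G := {
  mulg_cts : continuous (fun p : G * G => (p.1 * p.2)%g);
  invg_cts : continuous (fun x : G => (x^-1)%g)
}.

#[short(type="topGroupType")]
HB.structure Definition TopGroup :=
  {G of isTopGroup G & Group G & Topological G}.

Record subgroup (G : topGroupType) := Subgroup {
  sg_set :> set G;
  sg_one : sg_set 1%g;
  sg_mul : forall x y, sg_set x -> sg_set y -> sg_set (x * y)%g;
  sg_inv : forall x, sg_set x -> sg_set (x^-1)%g
}.

Section SubgroupTopGroup.
Variables (G : topGroupType) (T : subgroup G).
Let H : Type := set_type T.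
Implicit Types s t : H.

Let mk x (Tx : sg_set T x) : H := exist _ x (mem_set Tx).
Let one : H := mk (sg_one T).
Let mul s t : H := mk (sg_mul (set_valP s) (set_valP t)).
Let inv s : H := mk (sg_inv (set_valP s)).

Let mulA : associative mul.
Proof. by move=> s t u; apply: val_inj; exact: mulgA. Qed.
Let mul1 : left_id one mul.
Proof. by move=> s; apply: val_inj; exact: mul1g. Qed.
Let mul1' : right_id one mul.
Proof. by move=> s; apply: val_inj; exact: mulg1. Qed.
Let mulV : left_inverse one inv mul.
Proof. by move=> s; apply: val_inj; exact: mulVg. Qed.
Let mulV' : right_inverse one inv mul.
Proof. by move=> s; apply: val_inj; exact: mulgV. Qed.

HB.instance Definition _ :=
  isGroup.Build (set_type T) mulA mul1 mul1' mulV mulV'.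

Let mul_cts : continuous (fun p : H * H => (p.1 * p.2)%g).
Proof.
apply: to_set_type_cts.
apply: (comp_cts (@mulg_cts G)
  (f := fun p : H * H => (set_val p.1, set_val p.2))).
apply: pair_cts.
- by apply: comp_cts; [exact: set_val_cts|exact: fst_cts].
- by apply: comp_cts; [exact: set_val_cts|exact: snd_cts].
Qed.
Let inv_cts : continuous (fun x : H => (x^-1)%g).
Proof.
apply: to_set_type_cts.
apply: (comp_cts (@invg_cts G) (f := fun x : H => set_val x)).
exact: set_val_cts.
Qed.

HB.instance Definition _ := isTopGroup.Build (set_type T) mul_cts inv_cts.

End SubgroupTopGroup.

Lemma sg_valM (G : topGroupType) (T : subgroup G) (s t : T) :
  \val (s * t)%g = (\val s * \val t)%g.
Proof. by []. Qed.

Lemma sg_valV (G : topGroupType) (T : subgroup G) (s : T) :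
  \val (s^-1)%g = ((\val s)^-1)%g.
Proof. by []. Qed.

Lemma sg_val1 (G : topGroupType) (T : subgroup G) : \val (1%g : T) = 1%g.
Proof. by []. Qed.

Record rspace (H : topGroupType) := RSpace {
  rcar :> topologicalType;
  ract : rcar -> H -> rcar;
  ract1 : forall x, ract x 1%g = x;
  ractM : forall x s t, ract x (s * t)%g = ract (ract x s) t;
  ract_cts : continuous (fun p : rcar * H => ract p.1 p.2)
}.

Record lspace (H : topGroupType) := LSpace {
  lcar :> topologicalType;
  lact : H -> lcar -> lcar;
  lact1 : forall x, lact 1%g x = x;
  lactM : forall s t x, lact (s * t)%g x = lact s (lact t x);
  lact_cts : continuous (fun p : H * lcar => lact p.1 p.2)
}.

Section Orbits.
Variables (H : topGroupType) (X : rspace H).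

Definition orb_rel (x y : X) : bool := `[< exists t : H, y = ract x t >].

Let orb_refl : reflexive orb_rel.
Proof. by move=> x; apply/asboolP; exists 1%g; rewrite ract1. Qed.

Let orb_sym : symmetric orb_rel.
Proof.
have aux x y : orb_rel x y -> orb_rel y x.
  move=> /asboolP[t ->]; apply/asboolP; exists (t^-1)%g.
  by rewrite -ractM mulgV ract1.
by move=> x y; apply/idP/idP; exact: aux.
Qed.

Let orb_trans : transitive orb_rel.
Proof.
move=> y x z /asboolP[s ->] /asboolP[t ->]; apply/asboolP.
by exists (s * t)%g; rewrite ractM.
Qed.

Canonical orb_equiv := EquivRel orb_rel orb_refl orb_sym orb_trans.

Definition orb : Type := quotient_topology {eq_quot orb_equiv}.

HB.instance Definition _ := Quotient.copy orb (quotient_topology {eq_quot orb_equiv}).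
HB.instance Definition _ := Topological.copy orb (quotient_topology {eq_quot orb_equiv}).

Definition orb_pi (x : X) : orb := \pi_orb x.

Lemma orb_pi_cts : continuous orb_pi.
Proof. exact: (@pi_continuous _ {eq_quot orb_equiv}). Qed.

Lemma orb_piP x y : orb_pi x = orb_pi y <-> exists t : H, y = ract x t.
Proof.
split; first by move/(@eqquotP _ _ {eq_quot orb_equiv})/asboolP.
by move=> h; apply/(@eqquotP _ _ {eq_quot orb_equiv})/asboolP.
Qed.

Lemma orb_pi_act x t : orb_pi (ract x t) = orb_pi x.
Proof. by apply/esym/orb_piP; exists t. Qed.

Lemma orb_reprK (b : orb) : orb_pi (repr b) = b.
Proof. exact: reprK. Qed.

Lemma orb_openP (U : set orb) : open U = open (orb_pi @^-1` U).
Proof. by []. Qed.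

Lemma orb_repr x : exists t : H, repr (orb_pi x) = ract x t.
Proof. by apply/orb_piP; rewrite orb_reprK. Qed.

Lemma orb_pi_open (U : set X) : open U -> open (orb_pi @` U).
Proof.
move=> oU; rewrite orb_openP.
have -> : orb_pi @^-1` (orb_pi @` U) =
    \bigcup_(t in [set: H]) ((fun x => ract x t) @^-1` U).
  apply/seteqP; split=> [x [y Uy /esym/orb_piP[t yE]]|x [t _ Uxt]].
    by exists t => //=; rewrite -yE.
  by exists (ract x t) => //; exact: orb_pi_act.
apply: bigcup_open => t _; apply: open_comp => // x _.
apply: (comp_cts (@ract_cts _ X) (f := fun x => (x, t))).
by apply: pair_cts; [exact: id_cts|exact: cst_cts].
Qed.

Section Lift.
Variables (Z : topologicalType) (f : X -> Z).
Hypotheses (fc : continuous f) (ft : forall x t, f (ract x t) = f x).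

Definition orb_lift_fun (b : orb) : Z := f (repr b).

Lemma orb_liftE x : orb_lift_fun (orb_pi x) = f x.
Proof. by rewrite /orb_lift_fun; have [t ->] := orb_repr x. Qed.

Lemma orb_lift_cts : continuous orb_lift_fun.
Proof.
apply/continuousP => U oU; rewrite orb_openP.
have -> : orb_pi @^-1` (orb_lift_fun @^-1` U) = f @^-1` U.
  by apply/seteqP; split=> x /=; rewrite orb_liftE.
by move/continuousP: fc; apply.
Qed.

Definition orb_lift : continuousType orb Z := mkcts orb_lift_cts.
End Lift.

Lemma prod_orb_cts (Y Z : topologicalType) (f : Y * orb -> Z) :
  continuous (fun p : Y * X => f (p.1, orb_pi p.2)) -> continuous f.
Proof.
move=> cf [y b]; rewrite -(orb_reprK b); move: (repr b) => x U /= nU.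
have [[A B] /= [nA nB] sAB] := cf (y, x) U nU.
exists (A, orb_pi @` B) => /=; first split=> //.
  move: nB; rewrite !nbhsE => -[V [oV Vx] sVB].
  exists (orb_pi @` V); first by split; [exact: orb_pi_open|exists x].
  by move=> _ [v Vv <-]; exists v => //; exact: sVB.
by move=> [y' _] /= [Ay' [x' Bx' <-]]; exact: (sAB (y', x')).
Qed.

End Orbits.

Section OrbitMaps.
Variables (H : topGroupType).

Section Map.
Variables (X Y : rspace H) (f : X -> Y).
Hypotheses (fc : continuous f).
Hypothesis ft : forall x t, f (ract x t) = ract (f x) t.

Definition orb_map : continuousType (orb X) (orb Y) :=
  @orb_lift H X (orb Y) (fun x => orb_pi (f x))
    (comp_cts (@orb_pi_cts _ Y) fc)
    (fun x t => etrans (congr1 _ (ft x t)) (orb_pi_act (f x) t)).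

Lemma orb_mapE x : orb_map (orb_pi x) = orb_pi (f x).
Proof.
by apply: (@orb_liftE H X _ (fun y => orb_pi (f y))) => y t; rewrite ft orb_pi_act.
Qed.

End Map.

Section LeftAction.
Variables (K : topGroupType) (X : rspace H) (a : K -> X -> X).
Hypothesis a1 : forall x, a 1%g x = x.
Hypothesis aM : forall s t x, a (s * t)%g x = a s (a t x).
Hypothesis ac : continuous (fun p : K * X => a p.1 p.2).
Hypothesis aH : forall s x t, a s (ract x t) = ract (a s x) t.

Lemma lact_at_cts s : continuous (a s).
Proof.
apply: (comp_cts ac (f := fun x => (s, x))).
by apply: pair_cts; [exact: cst_cts|exact: id_cts].
Qed.

Definition orb_lact (s : K) : orb X -> orb X :=
  orb_map (@lact_at_cts s) (@aH s).

Lemma orb_lactE s x : orb_lact s (orb_pi x) = orb_pi (a s x).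
Proof. exact: orb_mapE. Qed.

Lemma orb_lact1 b : orb_lact 1%g b = b.
Proof. by rewrite -(orb_reprK b) orb_lactE a1. Qed.

Lemma orb_lactM s t b : orb_lact (s * t)%g b = orb_lact s (orb_lact t b).
Proof. by rewrite -(orb_reprK b) !orb_lactE aM. Qed.

Lemma orb_lact_cts : continuous (fun p : K * orb X => orb_lact p.1 p.2).
Proof.
apply: prod_orb_cts => /=; under eq_fun do rewrite orb_lactE.
exact: (comp_cts (@orb_pi_cts _ X) ac).
Qed.

Definition orb_lspace : lspace K :=
  @LSpace K (orb X) orb_lact orb_lact1 orb_lactM orb_lact_cts.

End LeftAction.
End OrbitMaps.

Section SingularCohomology.
Variable R : realType.

Definition simplex n : set 'rV[R]_n.+1 :=
  [set x | (forall i, 0 <= x 0 i) /\ \sum_i x 0 i = 1].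
Arguments simplex : clear implicits.

Lemma vertex_subproof n (i : 'I_n.+1) : simplex n (delta_mx 0 i).
Proof.
split=> [j|]; first by rewrite mxE ler0n.
rewrite (bigD1 i) //= mxE !eqxx big1 ?addr0 // => j /negbTE ji.
by rewrite mxE ji.
Qed.

Definition vertex n (i : 'I_n.+1) : simplex n :=
  SigSub (mem_set (vertex_subproof i)).

Definition insert0 n (i : 'I_n.+2) (x : 'rV[R]_n.+1) : 'rV[R]_n.+2 :=
  \row_j oapp (x 0) 0 (unlift i j).

Lemma insert0_subproof n (i : 'I_n.+2) (x : simplex n) :
  simplex n.+1 (insert0 i (set_val x)).
Proof.
have [x0 x1] := set_valP x; split=> [j|].
  by rewrite mxE; case: unlift => //= k; exact: x0.
rewrite (bigD1_ord i) //= mxE unlift_none add0r -[RHS]x1.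
by apply: eq_bigr => j _; rewrite mxE liftK.
Qed.

Definition coface n (i : 'I_n.+2) (x : simplex n) : simplex n.+1 :=
  SigSub (mem_set (insert0_subproof i x)).

Lemma rV_cts (X : topologicalType) m (f : X -> 'rV[R]_m) :
  (forall j, continuous (fun x => f x 0 j)) -> continuous f.
Proof.
move=> cf x A [P nP sPA].
suff : \forall y \near x, forall j, P 0 j (f y 0 j).
  apply: filterS => y Py; apply: sPA => i j; rewrite ord1; exact: Py.
by apply: filter_forall => j; apply: cf; exact: nP.
Qed.

Lemma coface_cts n (i : 'I_n.+2) : continuous (coface i).
Proof.
apply: to_set_type_cts; apply: rV_cts => j.
under eq_fun do rewrite mxE.
case: unlift => [k|] /=; last exact: cst_cts.
by apply: (comp_cts (@coord_continuous _ _ _ 0 k)); exact: set_val_cts.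
Qed.

Definition sing (X : topologicalType) n := continuousType (simplex n) X.

Definition face n (X : topologicalType) (i : 'I_n.+2) (s : sing X n.+1) :
  sing X n := mkcts (comp_cts (@cts_fun _ _ s) (@coface_cts n i)).

Definition cochain (X : topologicalType) n := sing X n -> rat.
HB.instance Definition _ X n := GRing.Zmodule.on (cochain X n).

Section Space.
Variable X : topologicalType.

Definition cobound n (c : cochain X n) : cochain X n.+1 :=
  fun s => \sum_(i < n.+2) (-1) ^+ i * c (face i s).

Lemma cobound_is_additive n : zmod_morphism (@cobound n).
Proof.
move=> c d; apply/funext => s.
transitivity (cobound c s - cobound d s) => //; rewrite /cobound -sumrB.
by apply: eq_bigr => i _; rewrite -mulrBr.
Qed.
HB.instance Definition _ n := GRing.isZmodMorphism.Build
  (cochain X n) (cochain X n.+1) (@cobound n) (@cobound_is_additive n).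

Definition is_cocycle n : {pred cochain X n} := [pred c | cobound c == 0].

Lemma is_cocycle_closed n : zmod_closed (@is_cocycle n).
Proof.
split=> [|c d /eqP c0 /eqP d0]; first by rewrite inE raddf0.
by rewrite inE raddfB /= c0 d0 subr0.
Qed.
HB.instance Definition _ n :=
  GRing.isZmodClosed.Build (cochain X n) (@is_cocycle n) (@is_cocycle_closed n).

Record cocycle n := Cocycle {
  cocycle_val :> cochain X n;
  cocycleP : cocycle_val \in @is_cocycle n
}.
HB.instance Definition _ n := [isSub for @cocycle_val n].
HB.instance Definition _ n := [Choice of @cocycle n by <:].
HB.instance Definition _ n := [SubChoice_isSubZmodule of @cocycle n by <:].

Definition coboundary n : cochain X n -> Prop :=
  if n is m.+1 then fun c => exists b : cochain X m, c = cobound b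
  else fun c => c = 0.

Definition is_coboundary n : {pred cocycle n} := [pred c | `[< coboundary (\val c) >]].

Lemma is_coboundaryP n (c : cocycle n) :
  reflect (coboundary (\val c)) (c \in @is_coboundary n).
Proof. exact: asboolP. Qed.

Lemma is_coboundary_closed n : zmod_closed (@is_coboundary n).
Proof.
split=> [|c d /is_coboundaryP cB /is_coboundaryP dB]; apply/is_coboundaryP.
  by rewrite raddf0; case: n => [//|n]; exists 0; rewrite raddf0.
rewrite raddfB; case: n c d cB dB => [|n] c d /=.
  by move=> -> ->; rewrite subr0.
by move=> [a ->] [b ->]; exists (a - b); rewrite raddfB.
Qed.
HB.instance Definition _ n :=
  GRing.isZmodClosed.Build (cocycle n) (@is_coboundary n) (@is_coboundary_closed n).

Definition cohomology n : zmodType := Quotient.quot (@is_coboundary n).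

Definition coclass n (c : cocycle n) : cohomology n :=
  \pi_(Quotient.quot (@is_coboundary n)) c.

End Space.

Lemma coclassP (X : topologicalType) n (c d : cocycle X n) :
  coclass c = coclass d <-> coboundary (\val c - \val d).
Proof.
rewrite -raddfB; split.
  by move/eqP; rewrite -Quotient.idealrBE => /is_coboundaryP.
by move/is_coboundaryP; rewrite Quotient.idealrBE => /eqP.
Qed.

Section Pullback.
Variables (X Y : topologicalType) (f : continuousType X Y).

Definition push_sing n (s : sing X n) : sing Y n := f \o s.

Definition pull_cochain n (c : cochain Y n) : cochain X n :=
  fun s => c (push_sing s).

Lemma pull_cobound n (c : cochain Y n) :
  cobound (pull_cochain c) = pull_cochain (cobound c).
Proof.
apply/funext => s; apply: eq_bigr => i _; congr (_ * c _).
exact/continuousEP.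
Qed.

Lemma pull_cocycle_subproof n (c : cocycle Y n) :
  pull_cochain (\val c) \in @is_cocycle X n.
Proof. by rewrite inE pull_cobound (eqP (cocycleP c)). Qed.

Definition pull_cocycle n (c : cocycle Y n) : cocycle X n :=
  Cocycle (pull_cocycle_subproof c).

Definition pullback n (a : cohomology Y n) : cohomology X n :=
  coclass (pull_cocycle (repr a)).

Lemma pullbackE n (c : cocycle Y n) :
  pullback (coclass c) = coclass (pull_cocycle c).
Proof.
have /coclassP : coclass (repr (coclass c)) = coclass c by exact: reprK.
rewrite /pullback => e; apply/coclassP; rewrite /=.
case: n c e => [|n] c /=.
  by move=> e; apply/funext => s; exact: (congr1 (fun h => h (push_sing s)) e).
move=> [b e]; exists (pull_cochain b); rewrite pull_cobound -e.
exact/funext.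
Qed.

Lemma pullback_is_additive n : zmod_morphism (@pullback n).
Proof.
move=> a b; rewrite -[a]reprK -[b]reprK -/(coclass _) -/(coclass _).
have coclassB (Z : topologicalType) m (c d : cocycle Z m) :
    coclass (c - d) = coclass c - coclass d by exact: raddfB.
rewrite -coclassB !pullbackE -coclassB; congr coclass.
exact/val_inj/funext.
Qed.
HB.instance Definition _ n := GRing.isZmodMorphism.Build
  (cohomology Y n) (cohomology X n) (@pullback n) (@pullback_is_additive n).

End Pullback.

(* A space over [B] on whose fibres the scalars act.  A complex line bundle is
   determined by this much: a line is a set with an action of the field which
   is isomorphic to the field acting on itself, its addition being transported
   along any such isomorphism. *)
Record cline (B : topologicalType) := Cline {
  ltot :> topologicalType;
  lproj : continuousType ltot B;
  lscale : cplx R -> ltot -> ltot;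
  lscale_proj : forall a x, lproj (lscale a x) = lproj x
}.

Section FirstChernClass.
Variables (B : topologicalType) (L : cline B).

Definition nonzero (x : L) : Prop := lscale 0 x <> x.

Definition nonzero_lift (Z : Type) (f : Z -> B) (s : Z -> L) : Prop :=
  forall z, lproj L (s z) = f z /\ nonzero (s z).

Definition polar (rho theta : R) : cplx R :=
  Complex (rho * cos theta) (rho * sin theta).

(* The obstruction cocycle of [L].  Choose a nonzero vector [s0 b] over each
   point [b] and a nowhere zero section [s1 e] along each singular edge [e]
   extending the chosen vectors at its ends.  The value on a singular triangle
   [s] is the winding number of the section so obtained over the boundary of
   the triangle, traversed along v0, v1, v2, v0, relative to a nowhere zero
   section [t] over the whole triangle: on the [i]-th face the ratio of the two
   is [rho i * exp (sqrt (-1) * theta i)], and the faces [v0 v1] ([i = 2]) and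
   [v1 v2] ([i = 0]) are traversed forwards, [v0 v2] ([i = 1]) backwards.  With
   this sign the class is the Euler class of [L] oriented by its complex
   structure, hence positive on the hyperplane bundle O(1). *)
Definition is_chern_cocycle (c : cocycle B 2) : Prop :=
  exists (s0 : B -> L) (s1 : sing B 1 -> simplex 1 -> L),
  [/\ nonzero_lift id s0,
      forall e : sing B 1,
        [/\ continuous (s1 e), nonzero_lift e (s1 e) &
            forall i, s1 e (vertex i) = s0 (e (vertex i))] &
      forall s : sing B 2,
      exists (t : simplex 2 -> L) (rho theta : 'I_3 -> simplex 1 -> R),
      [/\ continuous t, nonzero_lift s t,
          forall i, continuous (theta i) /\
            forall x, 0 < rho i x /\
              s1 (face i s) x =
                lscale (polar (rho i x) (theta i x)) (t (coface i x)) &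
          2 * pi * ratr (\val c s) =
            \sum_(i < 3) (-1) ^+ i *
              (theta i (vertex ord_max) - theta i (vertex ord0))]].

(* [xget] returns 0 if there is no obstruction cocycle, which does not happen
   when [L] is locally trivial; its class does not depend on the choices. *)
Definition c1 : cohomology B 2 := coclass (xget 0 is_chern_cocycle).

End FirstChernClass.

End SingularCohomology.

Section LieGroups.
Variable R : realType.

Fixpoint Ck (k : nat) (V W : normedModType R) (A : set V) (f : V -> W) : Prop :=
  if k is k'.+1 then
    (forall x v, A x -> derivable f x v) /\ (forall v, Ck k' A ('D_v f))
  else forall x, A x -> {for x, continuous f}.

Definition smooth_on (V W : normedModType R) (A : set V) (f : V -> W) : Prop :=
  forall k, Ck k A f.

Record chart (G : topologicalType) (d : nat) := Chart {
  cdom : set G;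
  cmap : G -> 'rV[R]_d;
  cinv : 'rV[R]_d -> G;
  cdom_open : open cdom;
  cimg_open : open (cmap @` cdom);
  cmap_cts : {within cdom, continuous cmap};
  cinv_cts : {within cmap @` cdom, continuous cinv};
  cmapK : forall x, cdom x -> cinv (cmap x) = x
}.

Definition cimg (G : topologicalType) d (c : chart G d) : set 'rV[R]_d :=
  cmap c @` cdom c.

Definition smooth_atlas (G : topologicalType) d (A : set (chart G d)) : Prop :=
  (forall x, exists2 c, A c & cdom c x) /\
  (forall a b, A a -> A b ->
     smooth_on (cimg a `&` cinv a @^-1` cdom b) (fun u => cmap b (cinv a u))).

Definition smooth_group_ops (G : topGroupType) d (A : set (chart G d)) : Prop :=
  (forall a b c, A a -> A b -> A c ->
     smooth_on
       [set p : 'rV[R]_d * 'rV[R]_d | [/\ cimg a p.1, cimg b p.2 &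
          cdom c (cinv a p.1 * cinv b p.2)%g]]
       (fun p => cmap c (cinv a p.1 * cinv b p.2)%g)) /\
  (forall a b, A a -> A b ->
     smooth_on (cimg a `&` [set u | cdom b ((cinv a u)^-1)%g])
       (fun u => cmap b ((cinv a u)^-1)%g)).

Definition lie_group (G : topGroupType) : Prop :=
  [/\ hausdorff_space G, @second_countable G &
      exists d (A : set (chart G d)), smooth_atlas A /\ smooth_group_ops A].

Definition circles (n : nat) : set 'rV[cplx R]_n :=
  [set z | forall i, `|z 0 i| = 1].
Arguments circles : clear implicits.

(* An isomorphism of topological groups with a product of circles.  In a Lie
   group its inclusion is automatically smooth. *)
Definition is_torus (G : topGroupType) (T : subgroup G) : Prop :=
  exists n (phi : circles n -> T) (psi : T -> circles n),
  [/\ continuous phi, continuous psi, cancel phi psi, cancel psi phi &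
      forall z w zw : circles n,
        (forall i, \val zw 0 i = \val z 0 i * \val w 0 i) ->
        phi zw = (phi z * phi w)%g].

Definition maximal_torus (G : topGroupType) (T : subgroup G) : Prop :=
  is_torus T /\
  forall T' : subgroup G, is_torus T' -> T `<=` T' -> T' `<=` T.

Definition contractible (E : topologicalType) : Prop :=
  exists (x0 : E) (h : E * R -> E),
  [/\ {within [set: E] `*` `[0, 1], continuous h},
      forall x, h (x, 0) = x & forall x, h (x, 1) = x0].

Definition principal_bundle (H : topGroupType) (X : rspace H) : Prop :=
  forall b : orb X,
  exists (U : set (orb X)) (theta : X -> H) (h : orb X * H -> X),
  [/\ open U /\ U b,
      {within @orb_pi H X @^-1` U, continuous theta},
      {within U `*` [set: H], continuous h},
      forall x t, U (orb_pi x) ->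
        theta (ract x t) = (theta x * t)%g /\ h (orb_pi x, theta x) = x &
      forall b' t, U b' ->
        orb_pi (h (b', t)) = b' /\ theta (h (b', t)) = t].

(* Any such [X] is a model of EH. *)
Definition universal_bundle (H : topGroupType) (X : rspace H) : Prop :=
  principal_bundle X /\ contractible X.

Record character (H : topGroupType) := Character {
  char_val :> H -> cplx R;
  char_cts : continuous char_val;
  char_neq0 : forall t, char_val t != 0;
  charM : forall s t, char_val (s * t)%g = char_val s * char_val t
}.

Definition character_basis (H : topGroupType) (l : nat)
    (chi : 'I_l -> character H) : Prop :=
  forall gamma : character H, exists! m : {ffun 'I_l -> int},
    forall t, gamma t = \prod_i (chi i t : R[i]) ^ m i.

End LieGroups.

Section BalancedProducts.
Variable H : topGroupType.

Section Product.
Variables (X : rspace H) (M : lspace H).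

Let act (p : X * M) (t : H) : X * M := (ract p.1 t, lact (t^-1)%g p.2).

Let actp1 p : act p 1%g = p.
Proof. by case: p => x m; rewrite /act ract1 invg1 lact1. Qed.
Let actM p s t : act p (s * t)%g = act (act p s) t.
Proof. by case: p => x m; rewrite /act /= ractM invgM lactM. Qed.
Let act_cts : continuous (fun q : (X * M) * H => act q.1 q.2).
Proof.
have c1 : continuous (fun q : (X * M) * H => q.1) by exact: fst_cts.
have c2 : continuous (fun q : (X * M) * H => q.2) by exact: snd_cts.
apply: pair_cts.
  apply: (comp_cts (@ract_cts _ X) (f := fun q : (X * M) * H => (q.1.1, q.2))).
  by apply: pair_cts => //; exact: (comp_cts (@fst_cts _ _) c1).
apply: (comp_cts (@lact_cts _ M)
  (f := fun q : (X * M) * H => ((q.2)^-1%g, q.1.2))).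
by apply: pair_cts; [exact: (comp_cts (@invg_cts H) c2)
                    |exact: (comp_cts (@snd_cts _ _) c1)].
Qed.

Definition prod_rspace : rspace H :=
  @RSpace H (X * M)%type act actp1 actM act_cts.

(* The balanced product (X x M) / H, for (x, m) t = (x t, t^-1 m). *)
Definition balanced : Type := orb prod_rspace.
HB.instance Definition _ := Topological.on balanced.

Definition bal (x : X) (m : M) : balanced := @orb_pi H prod_rspace (x, m).

Definition bal_proj : continuousType balanced (orb X) :=
  @orb_map H prod_rspace X (@fst X M) (@fst_cts X M) (fun _ _ => erefl).

Lemma bal_projE x m : bal_proj (bal x m) = orb_pi x.
Proof. exact: orb_mapE. Qed.

Lemma bal_act x t m : bal (ract x t) m = bal x (lact t m).
Proof.
apply/esym/orb_piP; exists t.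
by rewrite /= /act /= -lactM mulVg lact1.
Qed.

Lemma bal_surj (b : balanced) : exists x m, b = bal x m.
Proof.
by rewrite -(orb_reprK b); case: (repr b) => x m; exists x, m.
Qed.

End Product.

Section Map.
Variables (X : rspace H) (M N : lspace H) (f : M -> N).
Hypotheses (fc : continuous f) (ft : forall t x, f (lact t x) = lact t (f x)).

Let g (p : prod_rspace X M) : prod_rspace X N := (p.1, f p.2).
Let g_cts : continuous g.
Proof.
by apply: pair_cts; [exact: fst_cts|exact: (comp_cts fc (@snd_cts _ _))].
Qed.
Let gt p t : g (ract p t) = ract (g p) t.
Proof. by rewrite /g /= ft. Qed.

Definition bal_map : continuousType (balanced X M) (balanced X N) :=
  orb_map g_cts gt.

Lemma bal_mapE x m : bal_map (bal x m) = bal x (f m).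
Proof. exact: orb_mapE. Qed.

End Map.

Section StableSubspace.
Variables (M : lspace H) (A : set M).
Hypothesis At : forall t x, A x -> A (lact t x).

Let act (t : H) (x : A) : A := SigSub (mem_set (At t (set_valP x))).
Let actp1 x : act 1%g x = x.
Proof. by apply: val_inj; rewrite /= lact1. Qed.
Let actM s t x : act (s * t)%g x = act s (act t x).
Proof. by apply: val_inj; rewrite /= lactM. Qed.
Let act_cts : continuous (fun p : H * A => act p.1 p.2).
Proof.
apply: to_set_type_cts.
apply: (comp_cts (@lact_cts _ M) (f := fun p : H * A => (p.1, set_val p.2))).
apply: pair_cts; first exact: fst_cts.
by apply: comp_cts; [exact: set_val_cts|exact: snd_cts].
Qed.

Definition sub_lspace : lspace H := @LSpace H (set_type A) act actp1 actM act_cts.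

End StableSubspace.
End BalancedProducts.

Section LineBundles.
Variables (R : realType) (H : topGroupType).

Section Rep.
Variable gamma : character R H.

Let act (t : H) (v : cplx R) : cplx R := gamma t * v.
Let actp1 v : act 1%g v = v.
Proof.
have : gamma 1%g * gamma 1%g = gamma 1%g * 1 by rewrite -charM mulg1 mulr1.
by move/(mulfI (char_neq0 gamma _)) => e; rewrite /act e mul1r.
Qed.
Let actM s t v : act (s * t)%g v = act s (act t v).
Proof. by rewrite /act charM mulrA. Qed.
Let act_cts : continuous (fun p : H * cplx R => act p.1 p.2).
Proof.
move=> p; apply: (@cvgM R[i]); last exact: snd_cts.
by apply: (comp_cts (@char_cts _ _ gamma)); exact: fst_cts.
Qed.

Definition rep : lspace H := @LSpace H (cplx R) act actp1 actM act_cts.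

Lemma scale_cts (a : cplx R) : continuous (fun v : rep => a * v : rep).
Proof. exact: (@mulrl_continuous R[i]). Qed.

Lemma scale_equiv (a : cplx R) t (v : rep) : a * lact t v = lact t (a * v : rep).
Proof. by rewrite /= /act mulrCA. Qed.

End Rep.

Section Associated.
Variables (X : rspace H) (gamma : character R H).

Definition assoc_scale (a : cplx R) : balanced X (rep gamma) -> balanced X (rep gamma) :=
  bal_map X (@scale_cts gamma a) (@scale_equiv gamma a).

Lemma assoc_scaleE a x v : assoc_scale a (bal x v) = bal x (a * v : rep gamma).
Proof. exact: bal_mapE. Qed.

Lemma assoc_scale_proj a b : bal_proj X (rep gamma) (assoc_scale a b) = bal_proj X (rep gamma) b.
Proof. by have [x [v ->]] := bal_surj b; rewrite assoc_scaleE !bal_projE. Qed.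

Definition assoc_line : cline R (orb X) :=
  Cline assoc_scale_proj.

End Associated.

(* The line family over the balanced product of [X] with [N] induced by an
   equivariant line family [p : M -> N] with scalar multiplication [sc]. *)
Section Induced.
Variables (X : rspace H) (M N : lspace H) (p : M -> N) (sc : cplx R -> M -> M).
Hypotheses (pc : continuous p) (pt : forall t x, p (lact t x) = lact t (p x)).
Hypotheses (sc_cts : forall a, continuous (sc a))
  (sc_t : forall a t x, sc a (lact t x) = lact t (sc a x)).
Hypothesis sc_p : forall a x, p (sc a x) = p x.

Definition induced_scale (a : cplx R) : balanced X M -> balanced X M :=
  bal_map X (@sc_cts a) (sc_t a).

Lemma induced_scale_proj a b :
  bal_map X pc pt (induced_scale a b) = bal_map X pc pt b.
Proof.
by have [x [m ->]] := bal_surj b; rewrite /induced_scale !bal_mapE sc_p.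
Qed.

Definition induced_line : cline R (balanced X N) := Cline induced_scale_proj.

End Induced.
End LineBundles.

Section FlagManifold.
Variables (G : topGroupType) (T : subgroup G).

Section Restrict.
Variable X : rspace G.

Let act (x : X) (t : T) : X := ract x (\val t).
Let actp1 x : act x 1%g = x. Proof. exact: ract1. Qed.
Let actM x s t : act x (s * t)%g = act (act x s) t. Proof. exact: ractM. Qed.
Let act_cts : continuous (fun p : X * T => act p.1 p.2).
Proof.
apply: (comp_cts (@ract_cts _ X) (f := fun p : X * T => (p.1, \val p.2))).
apply: pair_cts; first exact: fst_cts.
by apply: comp_cts; [exact: set_val_cts|exact: snd_cts].
Qed.

Definition restrict : rspace T := @RSpace T X act actp1 actM act_cts.
End Restrict.

Definition regular : rspace G :=
  @RSpace G G (fun x y => (x * y)%g) (@mulg1 G) (@mulgA G) (@mulg_cts G).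

(* [G] as a right [T]-space; its orbit space is [G / T]. *)
Definition GoverT : rspace T := restrict regular.

Let ltrans (t : T) (g : GoverT) : GoverT := (\val t * g)%g.
Let ltrans1 g : ltrans 1%g g = g. Proof. exact: mul1g. Qed.
Let ltransM s t g : ltrans (s * t)%g g = ltrans s (ltrans t g).
Proof. by rewrite /ltrans /= mulgA. Qed.
Let ltrans_cts : continuous (fun p : T * GoverT => ltrans p.1 p.2).
Proof.
apply: (comp_cts (@mulg_cts G) (f := fun p : T * GoverT => (\val p.1, p.2))).
apply: pair_cts; last exact: snd_cts.
by apply: comp_cts; [exact: set_val_cts|exact: fst_cts].
Qed.
Let ltransR s g t : ltrans s (ract g t) = ract (ltrans s g) t.
Proof. by rewrite /ltrans /= mulgA. Qed.

Definition flag : lspace T := orb_lspace ltrans1 ltransM ltrans_cts ltransR.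

Definition coset (g : G) : flag := @orb_pi T GoverT g.

Lemma lact_coset t g : lact t (coset g) = coset (\val t * g)%g.
Proof. exact: orb_lactE. Qed.

Lemma cosetP g h : coset g = coset h <-> exists t : T, h = (g * \val t)%g.
Proof. exact: orb_piP. Qed.

Definition normalizer : set G :=
  [set n | forall t, sg_set T (n^-1 * t * n)%g <-> sg_set T t].

Definition weyl : set flag := coset @` normalizer.

Definition conj_norm n (Nn : normalizer n) (t : T) : T :=
  SigSub (mem_set ((Nn (\val t)).2 (set_valP t))).

Lemma normalizerM n (t : T) : normalizer n -> normalizer (n * \val t)%g.
Proof.
move=> Nn x; rewrite invgM -[X in _ <-> X]Nn.
have -> : ((\val t)^-1 * n^-1 * x * (n * \val t) =
  (\val t)^-1 * (n^-1 * x * n) * \val t)%g by rewrite !mulgA.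
split=> [h|h]; last first.
  by apply: sg_mul; [apply: sg_mul => //; apply: sg_inv|]; exact: (set_valP t).
have := sg_mul (sg_mul (set_valP t) h) (sg_inv (set_valP t)).
by rewrite -/(\val t) !mulgA mulgV mul1g mulgK.
Qed.

Lemma normalizer_repr (w : flag) : weyl w -> normalizer (repr w : G).
Proof.
move=> [n Nn <-]; have [t ->] := @orb_repr T GoverT n; exact: normalizerM.
Qed.

Lemma weyl_fixed (w : flag) : weyl w -> forall t : T, lact t w = w.
Proof.
move=> [n Nn <-] t; rewrite lact_coset; apply/esym/cosetP.
by exists (conj_norm Nn t); rewrite /= !mulgA mulgV mul1g.
Qed.

Section RightTranslation.
Variable X : rspace G.

Let f n (x : restrict X) : orb (restrict X) :=
  @orb_pi T (restrict X) (@ract G X x n).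

Let f_cts n : continuous (f n).
Proof.
apply: (comp_cts (@orb_pi_cts T (restrict X))).
apply: (comp_cts (@ract_cts G X) (f := fun x : X => (x, n))).
by apply: pair_cts; [exact: id_cts|exact: cst_cts].
Qed.

Let f_act n (Nn : normalizer n) x t : f n (ract x t) = f n x.
Proof.
apply/esym/orb_piP; exists (conj_norm Nn t).
by rewrite /= -!ractM !mulgA mulgV mul1g.
Qed.

Definition rtrans n (Nn : normalizer n) :
    continuousType (orb (restrict X)) (orb (restrict X)) :=
  orb_lift (@f_cts n) (f_act Nn).

Lemma rtransE n (Nn : normalizer n) (x : X) :
  rtrans Nn (@orb_pi T (restrict X) x) = @orb_pi T (restrict X) (ract x n).
Proof. exact: (orb_liftE (f_act Nn)). Qed.

(* [repr] may be replaced by any representative of [w]: see [weyl_transE]. *)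
Definition weyl_trans (w : weyl) :
    continuousType (orb (restrict X)) (orb (restrict X)) :=
  rtrans (normalizer_repr (set_valP w)).

Lemma weyl_transE (w : weyl) n (x : X) : coset n = \val w ->
  weyl_trans w (@orb_pi T (restrict X) x) = @orb_pi T (restrict X) (ract x n).
Proof.
move=> nw; rewrite /weyl_trans rtransE; apply/esym/orb_piP.
have /cosetP[t ->] : coset n = coset (repr (\val w) : G).
  by rewrite nw /coset orb_reprK.
by exists t; rewrite /= ractM.
Qed.

End RightTranslation.
End FlagManifold.

Arguments normalizer {G} T.
Arguments weyl {G} T.

Section FixedPoints.
Variables (R : realType) (G : topGroupType) (T : subgroup G) (n : G).

Let cT : set G := [set x | sg_set T (n^-1 * x * n)%g].
Let cT1 : cT 1%g.
Proof. by rewrite /cT /= mulg1 mulVg; exact: sg_one. Qed.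
Let cTM x y : cT x -> cT y -> cT (x * y)%g.
Proof.
by move=> Tx Ty; have := sg_mul Tx Ty; rewrite /cT /= !mulgA mulgK.
Qed.
Let cTV x : cT x -> cT (x^-1)%g.
Proof. by move=> Tx; have := sg_inv Tx; rewrite /cT /= !invgM invgK !mulgA. Qed.

Definition conj_subgroup : subgroup G := Subgroup cT1 cTM cTV.

Let to_cT_proof (t : T) : sg_set conj_subgroup (n * \val t * n^-1)%g.
Proof.
by rewrite /= /cT /= !mulgA mulVg mul1g mulgVK; exact: (set_valP t).
Qed.
Let to_cT (t : T) : conj_subgroup := SigSub (mem_set (to_cT_proof t)).
Let of_cT_proof (x : conj_subgroup) : sg_set T (n^-1 * \val x * n)%g.
Proof. exact: (set_valP x). Qed.
Let of_cT (x : conj_subgroup) : T := SigSub (mem_set (of_cT_proof x)).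

Let conj_cts (A : set G) (m : G) : continuous (fun x : A => (m * \val x * m^-1)%g).
Proof.
apply: (comp_cts (@mulg_cts G) (f := fun x : A => ((m * \val x)%g, (m^-1)%g))).
apply: pair_cts; last exact: cst_cts.
apply: (comp_cts (@mulg_cts G) (f := fun x : A => (m, \val x))).
by apply: pair_cts; [exact: cst_cts|exact: set_val_cts].
Qed.

Lemma is_torus_conj : is_torus R T -> is_torus R conj_subgroup.
Proof.
move=> [l [phi [psi [phic psic phiK psiK phiM]]]].
exists l, (fun z => to_cT (phi z)), (fun x => psi (of_cT x)); split.
- by apply: (comp_cts _ phic); apply: to_set_type_cts; exact: conj_cts.
- apply: (comp_cts psic); apply: to_set_type_cts => /=.
  by have := @conj_cts conj_subgroup (n^-1)%g; rewrite invgK.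
- move=> z; rewrite -[RHS]phiK; congr psi; apply: val_inj => /=.
  by rewrite !mulgA mulVg mul1g mulgVK.
- move=> x; apply: val_inj; rewrite /= psiK /=.
  by rewrite !mulgA mulgV mul1g mulgK.
- move=> z w zw /phiM e; apply: val_inj; rewrite /= e /=.
  by rewrite !mulgA mulgVK.
Qed.

End FixedPoints.

(* [T] being maximal, the Weyl group is the fixed point set of the left action
   of [T] on [G / T]. *)
Lemma weylE (R : realType) (G : topGroupType) (T : subgroup G) :
  maximal_torus R T ->
  weyl T = [set w : flag T | forall t : T, lact t w = w].
Proof.
move=> [torT maxT]; apply/seteqP; split=> [w Ww|w fixw]; first exact: weyl_fixed.
have [n wE] : exists n, w = coset T n by exists (repr w); rewrite /coset orb_reprK.
have nT t : sg_set T t -> sg_set T (n^-1 * t * n)%g.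
  move=> Tt; have := fixw (SigSub (mem_set Tt)).
  rewrite wE lact_coset => /esym/cosetP[s /= e].
  by rewrite -mulgA e mulgA mulVg mul1g; exact: (set_valP s).
exists n => // t; split; last exact: nT.
exact: (maxT _ (is_torus_conj n torT) nT).
Qed.

Section EquivariantCohomology.
Variables (R : realType) (G : topGroupType) (T : subgroup G) (EG : rspace G).

Let ET : rspace T := restrict T EG.

Definition classifying : topologicalType := orb ET.

Definition borel (M : lspace T) : topologicalType := balanced ET M.

Definition eq_cohomology (M : lspace T) n : zmodType := cohomology R (borel M) n.

(* The structure map H^n(BT) -> H_T^n(M): the map M_T -> pt_T induced by
   [M -> pt] becomes [bal_proj] under pt_T = BT. *)
Definition coeff (M : lspace T) n (a : cohomology R classifying n) :
    eq_cohomology M n :=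
  pullback (bal_proj ET M) a.

Section Point.
Variable w : weyl T.

Let stable (t : T) x : [set \val w] x -> [set \val w] (lact t x).
Proof. by move=> ->; exact: (weyl_fixed (set_valP w)). Qed.

Definition fixpt : lspace T := sub_lspace stable.

Let incl (x : fixpt) : flag T := \val x.

Definition borel_incl : continuousType (borel fixpt) (borel (flag T)) :=
  @bal_map T ET fixpt (flag T) incl (@set_val_cts _ _) (fun _ _ => erefl).

Definition the_pt : fixpt := SigSub (mem_set (erefl : [set \val w] (\val w))).

Lemma the_ptE (x : fixpt) : x = the_pt.
Proof. by apply: val_inj; exact: (set_valP x). Qed.

Let sec (e : ET) : prod_rspace ET fixpt := (e, the_pt).
Let sec_cts : continuous sec.
Proof. by apply: pair_cts; [exact: id_cts|exact: cst_cts]. Qed.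
Let sec_act e t : sec (ract e t) = ract (sec e) t.
Proof. by rewrite /sec /=; congr pair; rewrite [RHS]the_ptE. Qed.

Definition borel_pt : continuousType classifying (borel fixpt) :=
  orb_map sec_cts sec_act.

Lemma borel_ptE (e : ET) : borel_pt (orb_pi e) = @bal T ET fixpt e the_pt.
Proof. exact: orb_mapE. Qed.

Lemma borel_ptK : cancel borel_pt (bal_proj ET fixpt).
Proof.
move=> b; rewrite -(orb_reprK b) borel_ptE.
exact: (@bal_projE T ET fixpt (repr b) the_pt).
Qed.

Lemma borel_projK : cancel (bal_proj ET fixpt) borel_pt.
Proof.
move=> b; have [e [x ->]] := bal_surj b; rewrite bal_projE (the_ptE x).
exact: borel_ptE.
Qed.

(* Restriction along the inclusion of [{w}], followed by the identification of
   H_T^n({w}) with H^n(BT). *)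
Definition restr n (a : eq_cohomology (flag T) n) : cohomology R classifying n :=
  pullback borel_pt (pullback borel_incl a).

Definition weyl_act n (a : cohomology R classifying n) :
    cohomology R classifying n :=
  pullback (weyl_trans EG w) a.

End Point.

Section LineBundlesOfCharacters.
Variable gamma : character R T.

Definition Sline : cline R classifying := assoc_line ET gamma.

Definition Lline : cline R (flag T) := assoc_line (GoverT T) gamma.

Let Y : rspace T := prod_rspace (GoverT T) (rep gamma).
Let a (t : T) (p : Y) : Y := ((\val t * p.1)%g, p.2).
Let a1 p : a 1%g p = p.
Proof. by case: p => g v; rewrite /a /= mul1g. Qed.
Let aM s t p : a (s * t)%g p = a s (a t p).
Proof. by rewrite /a /= mulgA. Qed.
Let a_cts : continuous (fun q : T * Y => a q.1 q.2).
Proof.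
have c2 : continuous (fun q : T * Y => q.2) by exact: snd_cts.
apply: pair_cts; last exact: (comp_cts (@snd_cts _ _) c2).
apply: (comp_cts (@mulg_cts G) (f := fun q : T * Y => (\val q.1, q.2.1))).
apply: pair_cts; last exact: (comp_cts (@fst_cts _ _) c2).
by apply: comp_cts; [exact: set_val_cts|exact: fst_cts].
Qed.
Let aR s p t : a s (ract p t) = ract (a s p) t.
Proof. by rewrite /a /= mulgA. Qed.

Definition Ltot : lspace T := orb_lspace a1 aM a_cts aR.

Let br (g : G) (v : rep gamma) : Ltot := @bal T (GoverT T) (rep gamma) g v.

Lemma lact_Ltot t g v : lact t (br g v) = br (\val t * g)%g v.
Proof. exact: orb_lactE. Qed.

Let p (x : Ltot) : flag T := lproj Lline x.
Let sc (c : cplx R) (x : Ltot) : Ltot := @lscale _ _ Lline c x.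

Let pE g v : p (br g v) = coset T g.
Proof. exact: bal_projE. Qed.
Let scE c g v : sc c (br g v) = br g (c * v : rep gamma).
Proof. exact: assoc_scaleE. Qed.

Let pc : continuous p.
Proof. exact: cts_fun. Qed.
Let pt t x : p (lact t x) = lact t (p x).
Proof.
have [g [v ->]] := @bal_surj T (GoverT T) (rep gamma) x.
by rewrite -/(br g v) lact_Ltot !pE lact_coset.
Qed.
Let sc_cts c : continuous (sc c).
Proof. exact: cts_fun. Qed.
Let sc_t c t x : sc c (lact t x) = lact t (sc c x).
Proof.
have [g [v ->]] := @bal_surj T (GoverT T) (rep gamma) x.
by rewrite -/(br g v) lact_Ltot !scE lact_Ltot.
Qed.
Let sc_p c x : p (sc c x) = p x.
Proof. exact: lscale_proj. Qed.

Definition LlineT : cline R (borel (flag T)) :=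
  induced_line ET pc pt sc_cts sc_t sc_p.

Definition c1T : eq_cohomology (flag T) 2 := c1 LlineT.

End LineBundlesOfCharacters.
End EquivariantCohomology.

(* Main.v *)
Require Import Defs.
From HB Require Import structures.
From mathcomp Require Import all_boot all_order all_algebra.
From mathcomp Require Import all_classical all_reals all_analysis.
From mathcomp Require Import ring lra zify.
From mathcomp.real_closed Require Import complex.

Set Implicit Arguments.
Unset Strict Implicit.
Unset Printing Implicit Defensive.

Import Order.TTheory GRing.Theory Num.Theory.
Import numFieldNormedType.Exports.

Local Open Scope classical_set_scope.
Local Open Scope ring_scope.
Local Open Scope complex_scope.

(** The proof rests on the map [mu : (G/T)_T -> BT, [e, g T] |-> [e g]]
    ([borel_mul]).  It is covered by the bundle map [[e, [g, v]] |-> [e g, v]],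
    an isomorphism on fibres, which identifies the line [(L_gamma)_T] with the
    pullback of [S_gamma] along [mu] ([LlineT_square]).  Hence
    [c1T gamma = mu^* (c1 S_gamma)] ([c1T_pullback]).  The inclusion of the fixed
    point [w = n T] is [[e] |-> [e, n T]] on Borel constructions, and composing
    it with [mu] gives [[e] |-> [e n]], the right translation that defines the
    action of [w] on the cohomology of [BT] ([borel_mul_weyl]); functoriality of
    pullbacks then gives (ii).  For (i), the classes [u_i] come from [BT] along
    the projection [(G/T)_T -> BT], and [BT -> {w}_T -> (G/T)_T -> BT] is the
    identity.

    What carries the weight is the naturality of the first Chern class, here the
    class of an obstruction cocycle that is selected by choice, and 0 if there is
    none.  An obstruction cocycle pulls back to one ([is_chern_cocycle_pull]),
    and two obstruction cocycles of the same line are cohomologous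
    ([chern_cocycle_unique]): the sections they are built from have a continuous
    ratio, its argument lifts to a continuous real function on each simplex
    ([angle_lifting]), and the turns counted by this argument along the edges
    form a rational cochain whose coboundary is the difference.  As [mu] has the
    section [[e] |-> [e, T]], the line [S_gamma] is in turn the pullback of
    [(L_gamma)_T] along that section; so the two lines have obstruction cocycles
    together or not at all, and in the latter case both classes are 0
    ([c1_pullback]).

    Both the continuity of ratios of sections and that of the lifts through the
    bundle map come from one property of the free action of [T] on [EG]: an
    element of [T] that translates one point near [x] to another is close to 1
    ([free_proper], [assoc_coordinate]). *)

(** * Polar coordinates *)

Section Angles.
Variable R : realType.
Implicit Types (z : cplx R) (x rho theta : R).

Lemma polarM rho rho' theta theta' :
  polar rho theta * polar rho' theta' = polar (rho * rho') (theta + theta').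
Proof.
rewrite /polar; apply/eqP; rewrite eq_complex /= cosD sinD.
by apply/andP; split; apply/eqP; ring.
Qed.

(** On the right half-plane the argument has the closed form
    [atan (Im z / Re z)], which is continuous in [z]; this is the only branch of
    the argument from which longer lifts are assembled. *)
Lemma polar_atan z : 0 < complex.Re z ->
  exists2 rho, 0 < rho & z = polar rho (atan (complex.Im z / complex.Re z)).
Proof.
move: z => [a b] /= a0; set t := atan _.
have c0 : 0 < cos t by rewrite cos_gt0_pihalf// atan_gtNpi2 atan_ltpi2.
exists (a / cos t); first exact: divr_gt0.
have -> : b = a * tan t by rewrite atanK mulrC divfK// gt_eqF.
by rewrite /polar /tan; congr Complex; field; rewrite gt_eqF.
Qed.

Lemma polar_exists z : z != 0 ->
  exists rho theta, 0 < rho /\ z = polar rho theta.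
Proof.
move=> z0.
have pos (w : cplx R) : 0 < complex.Re w ->
    exists rho theta, 0 < rho /\ w = polar rho theta.
  by move=> /polar_atan[rho r0 e]; exists rho, (atan (complex.Im w / complex.Re w)).
move: z z0 => [a b] z0.
have [a0|a0|a0] := ltgtP 0 a.
- exact: pos.
- have /pos[rho [th [r0 e]]] : 0 < complex.Re (- Complex a b) by rewrite /= oppr_gt0.
  exists rho, (th + pi); split=> //; rewrite -[LHS]opprK e /polar.
  by rewrite cosDpi sinDpi !mulrN.
- rewrite -a0 in z0 *; have b0 : b != 0.
    by apply: contra_neq z0 => ->.
  have [b1|b1] := ltP 0 b.
    exists b, (pi / 2); split=> //.
    by rewrite /polar cos_pihalf sin_pihalf mulr0 mulr1.
  exists (- b), (- (pi / 2)); split; first by rewrite oppr_gt0 lt_neqAle b0.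
  by rewrite /polar cosN sinN cos_pihalf sin_pihalf mulr0 mulrN1 opprK.
Qed.

(** Reduce [x] modulo [2 * pi] into [[0, 2 * pi[]; there the half-angle formula
    makes [sin (y / 2)] vanish, while sine is positive on []0, pi[]. *)
Lemma cos_eq1 x : cos x = 1 -> exists m : int, x = 2 * pi * m%:~R.
Proof.
have p2 : 0 < 2 * pi :> R by rewrite mulr_gt0 ?pi_gt0.
move=> c1; pose m := Num.floor (x / (2 * pi)); exists m.
pose y := x - 2 * pi * m%:~R.
have y0 : 0 <= y.
  by rewrite subr_ge0 mulrC -ler_pdivlMr// Num.Theory.floor_le.
have y1 : y < 2 * pi.
  rewrite ltrBlDr -[X in X + _]mulr1 -mulrDr mulrC -ltr_pdivrMr// addrC.
  by rewrite -[1]/(1%:~R) -rmorphD/=; exact: Num.Theory.floorD1_gt.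
have cos_period (u : R) (k : int) : cos (u + 2 * pi * k%:~R) = cos u.
  have natp (v : R) (n : nat) : cos (v + 2 * pi * n%:R) = cos v.
    rewrite mulr_natl [_ * _%:R]mulr_natr.
    exact: (periodicn (@cosD2pi R)).
  case: k => n; first exact: natp.
  rewrite -[RHS](natp _ n.+1) NegzE mulrNz mulrN.
  by rewrite -{2}[u](subrK (2 * pi * n.+1%:R)) natp natp.
have cy : cos y = 1 by rewrite -c1 -(cos_period y m) subrK.
have s0 : sin (y / 2) = 0.
  apply/eqP; rewrite -sqrf_eq0 sin2cos2 subr_eq0; apply/eqP.
  have yy : y / 2 *+ 2 = y by rewrite -mulr_natr divfK ?pnatr_eq0.
  have := cos_mulr2n (y / 2); rewrite yy cy => e.
  by lra.
have : ~~ (0 < y / 2).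
  apply/negP => yp; have : 0 < sin (y / 2).
    by apply: sin_gt0_pi; rewrite yp /= ltr_pdivrMr// mulrC.
  by rewrite s0 ltxx.
rewrite -leNgt pmulr_lle0 ?invr_gt0// => yn.
by apply/eqP; rewrite -subr_eq0; apply/eqP/le_anti; rewrite -/y yn y0.
Qed.

(** Equal moduli leave [cos (theta - theta') = 1]. *)
Lemma polar_angle rho rho' theta theta' : 0 < rho -> 0 < rho' ->
  polar rho theta = polar rho' theta' ->
  exists m : int, theta - theta' = 2 * pi * m%:~R.
Proof.
move=> r0 r0' [ec es]; apply: cos_eq1; rewrite cosB.
have e1 := cos2Dsin2 theta; have e2 := cos2Dsin2 theta'.
set c := cos _ in ec e1 *; set s := sin _ in es e1 *.
set c' := cos _ in ec e2 *; set s' := sin _ in es e2 *.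
have err : rho = rho'.
  apply/eqP; rewrite -(eqrXn2 (n := 2))// ?ltW//; apply/eqP.
  rewrite -[LHS]mulr1 -[RHS]mulr1 -{1}e1 -e2 !mulrDr -!exprMn.
  by rewrite ec es.
move: ec es; rewrite err => /(mulfI (lt0r_neq0 r0')) ->.
by move=> /(mulfI (lt0r_neq0 r0')) ->; rewrite -!expr2.
Qed.

End Angles.

(** * Continuous arguments of nowhere zero functions *)

Section AngleLifting.
Variable R : realType.

Lemma Re_cts : continuous (@complex.Re R : cplx R -> R).
Proof.
move=> z A /nbhs_ballP[e /= e0 eA]; apply/nbhs_ballP.
exists (e%:C : R[i]); rewrite /= ?ltcR// => w.
rewrite /ball/= /ball_/= => zw.
apply: eA; rewrite /ball/= -ltcR; apply: le_lt_trans zw; rewrite -raddfB.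
exact: normc_ge_Re.
Qed.

Lemma Im_cts : continuous (@complex.Im R : cplx R -> R).
Proof.
move=> z A /nbhs_ballP[e /= e0 eA]; apply/nbhs_ballP.
exists (e%:C : R[i]); rewrite /= ?ltcR// => w.
rewrite /ball/= /ball_/= => zw.
apply: eA; rewrite /ball/= -ltcR; apply: le_lt_trans zw; rewrite -raddfB.
case: (_ - _) => a b.
by rewrite normc_def lecR/= -sqrtr_sqr ler_wsqrtr// lerDr sqr_ge0.
Qed.

Lemma cplx_div_cts (Z : topologicalType) (f g : Z -> cplx R) :
  continuous f -> continuous g -> (forall z, g z != 0) ->
  continuous (fun z => f z / g z).
Proof.
move=> fc gc g0 z; apply: (@cvgM R[i]); first exact: fc.
by apply: (@cvgV R[i]); [exact: g0|exact: gc].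
Qed.

(** If [g / f] stays in the right half-plane, a continuous argument of [f]
    continues to one of [g] by adding the principal argument of [g / f]. *)
Lemma angle_step (Z : topologicalType) (f g : Z -> cplx R) (theta : Z -> R) :
  continuous f -> continuous g -> (forall z, f z != 0) ->
  (forall z, 0 < complex.Re (g z / f z)) ->
  continuous theta ->
  (forall z, exists2 rho, 0 < rho & f z = polar rho (theta z)) ->
  exists2 theta' : Z -> R, continuous theta' &
    forall z, exists2 rho, 0 < rho & g z = polar rho (theta' z).
Proof.
move=> fc gc f0 gf thetac fE.
have qc := cplx_div_cts gc fc f0.
exists (fun z =>
  atan (complex.Im (g z / f z) / complex.Re (g z / f z)) + theta z).
  move=> z; apply: cvgD; last exact: thetac.
  apply: continuous_comp; last exact: continuous_atan.
  apply: cvgM; first exact: (comp_cts Im_cts qc).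
  by apply: cvgV; [rewrite gt_eqF|exact: (comp_cts Re_cts qc)].
move=> z; have [r r0 e] := fE z; have [r' r0' e'] := polar_atan (gf z).
exists (r' * r); first exact: mulr_gt0.
by rewrite -polarM -e' -e divfK.
Qed.

(** Uniform continuity along [[0, 1]] in ratio form: at [s' = s] the ratio is 1,
    so it has positive real part near the diagonal, and compactness of
    [Z * [0, 1]] makes the neighbourhood uniform. *)
Lemma ratio_Re_gt0 (Z : topologicalType) (f : Z * R -> cplx R) :
  compact [set: Z] -> continuous f -> (forall p, f p != 0) ->
  exists N : nat, forall z s s', 0 <= s <= 1 -> `|s - s'| <= N.+1%:R^-1 ->
    0 < complex.Re (f (z, s') / f (z, s)).
Proof.
move=> cZ fc f0.
pose q (p : (Z * R) * R) := complex.Re (f (p.1.1, p.2) / f p.1).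
have qc : continuous q.
  apply: (comp_cts Re_cts); apply: cplx_div_cts => //.
    apply: (comp_cts fc); apply: pair_cts; last exact: snd_cts.
    by apply: comp_cts; [exact: fst_cts|exact: fst_cts].
  by apply: (comp_cts fc); exact: fst_cts.
have cK := compact_setX cZ (@segment_compact R 0 1).
move/compact_near_coveringP: cK => /(_ nat \oo
  (fun N p => forall s', `|p.2 - s'| <= N.+1%:R^-1 -> 0 < q (p, s'))).
case=> [[z s] _ /=|N _ NP]; last first.
  exists N => z s s' s01 ss'; apply: (NP N _ (z, s)) => //=.
have q1 : q ((z, s), s) = 1 by rewrite /q /= divff.
have : nbhs ((z, s), s) [set p | 0 < q p].
  apply: (qc _ [set x | 0 < x]); rewrite q1; apply: open_nbhs_nbhs.
  by split; [exact: open_gt|exact: ltr01].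
case=> -[A B] /= [nA /nbhs_ballP[e /= e0 eB]] AB.
have e2 : 0 < e / 2 by rewrite divr_gt0.
exists (A `&` [set p : Z * R | ball s (e / 2) p.2], [set N | N.+1%:R^-1 < e / 2]).
  split=> /=.
    apply: filterI => //.
    by apply: (@snd_cts Z R (z, s)); exact: nbhsx_ballx.
  exact: near_infty_natSinv_lt (PosNum e2).
move=> [[z' t] N] /= [[Azt st] Ne] s' ts'.
apply: (AB ((z', t), s')); split=> //=; apply: eB.
by apply: (ball_split st); rewrite /ball /=; exact: le_lt_trans Ne.
Qed.

(** Homotopy lifting for the exponential.  Cut [[0, 1]] into [N.+1] steps so
    small that successive values of [lam] along the contraction have ratio in
    the right half-plane.  At time 0 the function is the constant [lam z0], with
    a constant argument, and [angle_step] carries a continuous argument through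
    the steps up to time 1, where the function is [lam]. *)
Lemma angle_lifting (Z : topologicalType) (z0 : Z) (h : Z * R -> Z)
    (lam : Z -> cplx R) :
  compact [set: Z] -> continuous h ->
  (forall z, h (z, 0) = z0) -> (forall z, h (z, 1) = z) ->
  continuous lam -> (forall z, lam z != 0) ->
  exists2 theta : Z -> R, continuous theta &
    forall z, exists2 rho, 0 < rho & lam z = polar rho (theta z).
Proof.
move=> cZ hc h0 h1 lamc lam0.
have fc := comp_cts lamc hc.
have [N NP] := ratio_Re_gt0 cZ fc (fun p => lam0 (h p)).
pose s k : R := k%:R / N.+1%:R.
have fk k : continuous (fun z => lam (h (z, s k))).
  by apply: (comp_cts fc); apply: pair_cts; [exact: id_cts|exact: cst_cts].
suff /(_ N.+1 (leqnn _)) : forall k, (k <= N.+1)%N ->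
    exists2 theta : Z -> R, continuous theta &
      forall z, exists2 rho, 0 < rho & lam (h (z, s k)) = polar rho (theta z).
  move=> [theta tc tE]; exists theta => // z; have [rho r0] := tE z.
  by rewrite /s divff ?pnatr_eq0// h1; exists rho.
elim=> [_|k IHk kN].
  have [rho [t [r0 e]]] := polar_exists (lam0 z0).
  exists (fun=> t); first exact: cst_cts.
  by move=> z; exists rho => //; rewrite /s mul0r h0.
have [theta tc tE] := IHk (ltnW kN).
apply: (angle_step (fk k) (fk k.+1)) tc tE => // z.
apply: NP; rewrite /s.
  by rewrite divr_ge0//= ler_pdivrMr// mul1r ler_nat ltnW.
rewrite -mulrBl normrM distrC -natr1 addrAC subrr add0r normr1 mul1r.
by rewrite ger0_norm.
Qed.

End AngleLifting.

(** * Simplices are compact and contractible *)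

Section Simplices.
Variable R : realType.

(** Along the contraction path from [z0] to [z] the function [d / (2 * pi)] is a
    continuous integer-valued function on [[0, 1]]; two different values [m]
    and [k] would force it to take a half-integer value in between. *)
Lemma int_valued_constant (Z : topologicalType) (z0 : Z) (h : Z * R -> Z)
    (d : Z -> R) :
  continuous h -> (forall z, h (z, 0) = z0) -> (forall z, h (z, 1) = z) ->
  continuous d -> (forall z, exists m : int, d z = 2 * pi * m%:~R) ->
  forall z z', d z = d z'.
Proof.
move=> hc h0 h1 dc dZ.
suff dz z : d z = d z0 by move=> z z'; rewrite !dz.
have p2 : 2 * pi != 0 :> R by rewrite mulf_neq0 ?gt_eqF ?pi_gt0.
pose f s := d (h (z, s)) / (2 * pi).
have fZ s : exists m : int, f s = m%:~R.
  rewrite /f; have [m ->] := dZ (h (z, s)).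
  by exists m; rewrite mulrAC divff ?mul1r.
have fc : continuous f.
  move=> s; apply: cvgM; last exact: cvg_cst.
  apply: (comp_cts (comp_cts dc hc) (f := fun s => (z, s))).
  by apply: pair_cts; [exact: cst_cts|exact: id_cts].
suff e : f 0 = f 1 by move: e; rewrite /f h0 h1 => /(mulIf (invr_neq0 p2)).
have no_half (m k : int) : m%:~R + 2^-1 <> k%:~R :> R.
  move=> /(congr1 (fun x => x * 2)); rewrite mulrDl mulVf ?pnatr_eq0//.
  rewrite -[2]/(2%:~R) -[1]/(1%:~R) -!rmorphM -rmorphD/= => /intr_inj.
  (* The equation has become [m * 2 + 1 = k * 2]. *)
  by move=> ?; lia.
have half_le (m k : int) : m%:~R < k%:~R :> R -> m%:~R + 2^-1 <= k%:~R :> R.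
  rewrite ltr_int -lezD1 -(ler_int R) rmorphD/=; apply: le_trans.
  by rewrite lerD2l invf_le1 ?ler1n.
have [m0 e0] := fZ 0; have [m1 e1] := fZ 1.
have mid v : Num.min (f 0) (f 1) <= v <= Num.max (f 0) (f 1) ->
    exists s, f s = v.
  move=> v01; have [s _ <-] : exists2 c, c \in `[0%R, 1%R] & f c = v.
    by apply: IVT => //; apply: continuous_subspaceT.
  by exists s.
have [lt01|lt10|//] := ltgtP (f 0) (f 1).
- have [|s es] := mid (m0%:~R + 2^-1).
    rewrite (min_l (ltW lt01)) (max_r (ltW lt01)) e0 e1.
    by rewrite lerDl invr_ge0 ler0n half_le// -e0 -e1.
  by have [k ek] := fZ s; case: (@no_half m0 k); rewrite -es.
- have [|s es] := mid (m1%:~R + 2^-1).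
    rewrite (min_r (ltW lt10)) (max_l (ltW lt10)) e0 e1.
    by rewrite lerDl invr_ge0 ler0n half_le// -e0 -e1.
  by have [k ek] := fZ s; case: (@no_half m1 k); rewrite -es.
Qed.

Lemma compact_set_type (X : topologicalType) (A : set X) :
  compact A -> compact [set: A].
Proof.
move=> /compact_near_coveringP cA; apply/compact_near_coveringP => J F P FF PF.
have /cA : forall x, A x -> \near x & F, (forall a : A, \val a = x -> P F a).
  move=> x Ax; have [[U V] /= [nU FV] UV] := PF (SigSub (mem_set Ax)) I.
  move: nU; rewrite nbhsE /= => -[W [[W' oW' WE] Wx] WU].
  exists (W', V) => /=.
    split=> //; apply: open_nbhs_nbhs; split=> //.
    by have : (\val @^-1` W') (SigSub (mem_set Ax) : A) by rewrite WE.
  move=> [y i] /= [W'y Vi] a ay; apply: (UV (a, i)); split=> //.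
  by apply: WU; rewrite -WE; move: W'y; rewrite -ay.
apply: filterS => i AP a _; apply: (AP (\val a)) => //; exact: set_valP.
Qed.

Lemma simplex_compact n : compact [set: @simplex R n].
Proof.
apply: compact_set_type.
have cK := @rV_compact R n.+1 (fun=> `[0, 1]%classic)
  (fun=> @segment_compact R 0 1).
apply: (subclosed_compact _ cK).
  have -> : @simplex R n = (\bigcap_i [set x | 0 <= x 0 i]) `&`
      [set x | \sum_i x 0 i = 1].
    by apply/seteqP; split=> x [x0 x1]; split=> // i *; exact: x0.
  have coord i : continuous (fun x : 'rV[R]_n.+1 => x 0 i).
    exact: coord_continuous.
  apply: closedI.
    apply: closed_bigI => i _.
    exact: (preimage_closed (fun x _ => coord i x) (@closed_ge R 0)).
  have sum_cts : continuous (fun x : 'rV[R]_n.+1 => \sum_i x 0 i).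
    by apply: continuous_big => [|i _]; [exact: add_continuous|exact: coord].
  exact: (preimage_closed (fun x _ => sum_cts x) (@closed_eq R 1)).
move=> x [x0 x1] i /=; rewrite in_itv/= x0 -x1 (bigD1 i)//= lerDl.
by apply: sumr_ge0 => j _; exact: x0.
Qed.

(* Truncating the time to [[0, 1]] makes the straight-line contraction of the
   simplex onto its first vertex a total map, continuous on [simplex * R]. *)
Let clamp (s : R) : R := Num.max 0 (Num.min 1 s).

Lemma simplex_segment_subproof n (p : @simplex R n * R) :
  @simplex R n (clamp p.2 *: set_val p.1 + (1 - clamp p.2) *: delta_mx 0 0).
Proof.
have [x0 x1] := set_valP p.1; have [v0 v1] := @vertex_subproof R n ord0.
have c0 : 0 <= clamp p.2 by rewrite le_max lexx.
have c1 : 0 <= 1 - clamp p.2 by rewrite subr_ge0 ge_max ler01 ge_min lexx.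
split=> [i|].
  by rewrite !mxE addr_ge0// mulr_ge0//; have := v0 i; rewrite mxE.
under eq_bigr do rewrite mxE [X in X + _]mxE [X in _ + X]mxE.
by rewrite big_split/= -!mulr_sumr x1 v1 !mulr1 addrC subrK.
Qed.

Definition simplex_contraction n (p : @simplex R n * R) : @simplex R n :=
  SigSub (mem_set (simplex_segment_subproof p)).

Lemma simplex_contraction_cts n : continuous (@simplex_contraction n).
Proof.
have clamp_cts : continuous clamp.
  move=> s; apply: continuous_max; first exact: cvg_cst.
  by apply: continuous_min; [exact: cvg_cst|exact: cvg_id].
apply: to_set_type_cts; apply: rV_cts => j.
under eq_fun do rewrite !mxE.
have c2 : continuous (fun p : @simplex R n * R => clamp p.2).
  by apply: comp_cts; [exact: clamp_cts|exact: snd_cts].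
have c1 : continuous (fun p : @simplex R n * R => set_val p.1 0 j).
  apply: (comp_cts (@coord_continuous _ _ _ 0 j)).
  by apply: comp_cts; [exact: set_val_cts|exact: fst_cts].
move=> p; apply: cvgD; apply: cvgM.
- exact: c2.
- exact: c1.
- by apply: cvgB; [exact: cvg_cst|exact: c2].
- exact: cvg_cst.
Qed.

Lemma simplex_contraction0 n x : @simplex_contraction n (x, 0) = vertex R ord0.
Proof.
apply: val_inj => /=; rewrite /clamp min_r ?ler01// maxxx.
by rewrite scale0r add0r subr0 scale1r.
Qed.

Lemma simplex_contraction1 n x : @simplex_contraction n (x, 1) = x.
Proof.
apply: val_inj => /=; rewrite /clamp minxx max_r ?ler01//.
by rewrite subrr scale0r addr0 scale1r.
Qed.

Lemma simplex_angle n (lam : @simplex R n -> cplx R) :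
  continuous lam -> (forall x, lam x != 0) ->
  exists2 theta : @simplex R n -> R, continuous theta &
    forall x, exists2 rho, 0 < rho & lam x = polar rho (theta x).
Proof.
exact: (angle_lifting (@simplex_compact n) (@simplex_contraction_cts n)
  (@simplex_contraction0 n) (@simplex_contraction1 n)).
Qed.

Lemma simplex_int_valued n (d : @simplex R n -> R) :
  continuous d -> (forall x, exists m : int, d x = 2 * pi * m%:~R) ->
  forall x y, d x = d y.
Proof.
exact: (int_valued_constant (@simplex_contraction_cts n)
  (@simplex_contraction0 n) (@simplex_contraction1 n)).
Qed.

Lemma coface_vertex n (i : 'I_n.+2) (k : 'I_n.+1) :
  coface i (vertex R k) = vertex R (lift i k).
Proof.
apply: val_inj; apply/rowP => j; rewrite /= !mxE.
case: unliftP => [m ->|->] /=; first by rewrite mxE (inj_eq lift_inj).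
by rewrite (negbTE (neq_lift _ _)).
Qed.

(** The boundary of the boundary of a triangle, seen on a function of its
    vertices. *)
Lemma boundary_sum (f : 'I_3 -> R) :
  \sum_(i < 3) (-1) ^+ i * (f (lift i (ord_max : 'I_2)) - f (lift i ord0)) = 0.
Proof.
pose b : 'I_3 := inord 1; pose c : 'I_3 := inord 2.
rewrite (eq_bigr (fun i : 'I_3 => (-1) ^+ i *
  (f (if i == c then b else c) - f (if i == ord0 then b else ord0)))).
  by rewrite !big_ord_recl big_ord0 /= -!(inj_eq val_inj) /= !inordK//=; ring.
move=> i _; congr (_ * (f _ - f _)); apply: val_inj.
  by case: i => -[|[|[|//]]] ? /=; rewrite -(inj_eq val_inj)/= !inordK.
by case: i => -[|[|[|//]]] ? /=; rewrite /= ?inordK.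
Qed.

End Simplices.

(** * Functoriality of pullbacks *)

Section Functoriality.
Variable R : realType.

Lemma pullback_comp (X Y Z : topologicalType) (f : continuousType X Y)
    (g : continuousType Y Z) (k : continuousType X Z) n (a : cohomology R Z n) :
  (forall x, g (f x) = k x) -> pullback f (pullback g a) = pullback k a.
Proof.
move=> gf; rewrite -[a]reprK -/(coclass _) !pullbackE; congr coclass.
apply/val_inj/funext => s /=; rewrite /pull_cochain; congr (\val _ _).
by apply/continuousEP => x; exact: gf.
Qed.

Lemma pullback_id (X : topologicalType) (f : continuousType X X) n
    (a : cohomology R X n) :
  (forall x, f x = x) -> pullback f a = a.
Proof.
move=> fE; rewrite -[a]reprK -/(coclass _) pullbackE; congr coclass.
apply/val_inj/funext => s /=; rewrite /pull_cochain; congr (\val _ _).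
by apply/continuousEP => x; exact: fE.
Qed.

End Functoriality.

(** * Uniqueness of the obstruction class *)

Section Lines.
Variable R : realType.

Lemma fun_addr_cts (Z : topologicalType) (f g : Z -> R) :
  continuous f -> continuous g -> continuous (fun z => f z + g z).
Proof. by move=> fc gc z; apply: cvgD; [exact: fc|exact: gc]. Qed.

Lemma fun_subr_cts (Z : topologicalType) (f g : Z -> R) :
  continuous f -> continuous g -> continuous (fun z => f z - g z).
Proof. by move=> fc gc z; apply: cvgB; [exact: fc|exact: gc]. Qed.

(** What the obstruction theory of a line family uses of a complex line bundle:
    the scalars act freely on nonzero vectors, and the ratio of two nowhere zero
    sections over the same map is a continuous function.  Local triviality
    would imply this, but these properties pass through pullbacks more
    directly. *)
Record regular_line (B : topologicalType) (L : cline R B) : Prop := {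
  scaleA : forall a b (x : L), lscale a (lscale b x) = lscale (a * b) x;
  scale_inj : forall a b (x : L), nonzero x -> lscale a x = lscale b x -> a = b;
  scale_div : forall (Z : topologicalType) (f : Z -> B) (s s' : Z -> L),
    continuous s -> continuous s' -> nonzero_lift f s -> nonzero_lift f s' ->
    exists2 lam : Z -> cplx R, continuous lam &
      forall z, lam z != 0 /\ s' z = lscale (lam z) (s z)
}.

Lemma section_ratio (B : topologicalType) (L : cline R B) n
    (f : @simplex R n -> B) (s s' : @simplex R n -> L) :
  regular_line L -> continuous s -> continuous s' ->
  nonzero_lift f s -> nonzero_lift f s' ->
  exists2 theta : @simplex R n -> R, continuous theta &
    forall x, exists2 rho, 0 < rho & s' x = lscale (polar rho (theta x)) (s x).
Proof.
move=> regL sc sc' sf sf'.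
have [lam lamc lamE] := scale_div regL sc sc' sf sf'.
have [theta tc tE] := simplex_angle lamc (fun x => (lamE x).1).
exists theta => // x; have [rho r0 e] := tE x; exists rho => //.
by rewrite -e; exact: (lamE x).2.
Qed.

Section Uniqueness.
Variables (B : topologicalType) (L : cline R B).
Hypothesis regL : regular_line L.

Lemma angle_diff rho theta rho' theta' (x : L) :
  nonzero x -> 0 < rho -> 0 < rho' ->
  lscale (polar rho theta) x = lscale (polar rho' theta') x ->
  exists m : int, theta - theta' = 2 * pi * m%:~R.
Proof.
by move=> x0 r0 r0' /(scale_inj regL x0); exact: polar_angle.
Qed.

Lemma point_ratio (x y : L) : nonzero x -> nonzero y -> lproj L x = lproj L y ->
  exists theta rho, 0 < rho /\ y = lscale (polar rho theta) x.
Proof.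
move=> x0 y0 xy.
(* Constant sections over any nonempty space will do. *)
have [||z|z|lam _ /(_ (vertex R (ord0 : 'I_1)))[l0 ->]] :=
  @scale_div _ _ regL (@simplex R 0) (fun=> lproj L x) (fun=> x) (fun=> y);
  [exact: cst_cts|exact: cst_cts|by []|by []|].
have [rho [theta [r0 ->]]] := polar_exists l0.
by exists theta, rho.
Qed.

Variables (s0 s0' : B -> L) (s1 s1' : sing R B 1 -> @simplex R 1 -> L).
Hypothesis s1P : forall e : sing R B 1,
  [/\ continuous (s1 e), nonzero_lift e (s1 e) &
      forall i, s1 e (vertex R i) = s0 (e (vertex R i))].
Hypothesis s1P' : forall e : sing R B 1,
  [/\ continuous (s1' e), nonzero_lift e (s1' e) &
      forall i, s1' e (vertex R i) = s0' (e (vertex R i))].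
Variable alpha0 : B -> R.
Hypothesis alpha0P : forall b, exists rho, 0 < rho /\
  s0' b = lscale (polar rho (alpha0 b)) (s0 b).

(** The continuous argument [alpha] of [s1' / s1] along an edge and the chosen
    arguments [alpha0] of [s0' / s0] at its ends agree modulo [2 * pi], so
    their increments along the edge differ by a whole number [m] of turns; it is
    the value on the edge of the cochain relating two obstruction cocycles. *)
Lemma edge_winding (e : sing R B 1) :
  exists m : int, exists2 alpha : @simplex R 1 -> R,
    continuous alpha /\
    (forall x, exists2 rho, 0 < rho &
       s1' e x = lscale (polar rho (alpha x)) (s1 e x)) &
    2 * pi * m%:~R = (alpha (vertex R ord_max) - alpha (vertex R ord0)) -
      (alpha0 (e (vertex R ord_max)) - alpha0 (e (vertex R ord0))).
Proof.
have [sc sl sv] := s1P e; have [sc' sl' sv'] := s1P' e.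
have [alpha ac aE] := section_ratio regL sc sc' sl sl'.
have av i : exists m : int,
    alpha (vertex R i) - alpha0 (e (vertex R i)) = 2 * pi * m%:~R.
  have [rho r0] := aE (vertex R i).
  have [rho' [r0' e']] := alpha0P (e (vertex R i)).
  rewrite sv sv' e' => /esym; apply: angle_diff => //.
  by rewrite -sv; exact: (sl _).2.
have [m1 e1] := av ord_max; have [m0 e0] := av ord0.
exists (m1 - m0), alpha => //; rewrite rmorphB/= mulrBr -e1 -e0.
by rewrite !opprD !opprK !addrA; ring.
Qed.

End Uniqueness.

(** The obstruction class is independent of the choices: [c' - c] is the
    coboundary of the cochain [m] of [edge_winding].  Over a triangle let [beta]
    be a continuous argument of [t' / t].  On the [i]-th face the arguments
    [theta' + beta] and [alpha + theta] of [s1' / t] differ by a constant, so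
    [2 * pi * m] equals the increment of [theta' - theta], plus that of [beta],
    minus that of [alpha0].  The last two are differences of functions of the
    vertices, and cancel in the alternating sum over the boundary. *)
Lemma chern_cocycle_unique (B : topologicalType) (L : cline R B)
    (c c' : cocycle R B 2) :
  regular_line L -> is_chern_cocycle L c -> is_chern_cocycle L c' ->
  coclass c = coclass c'.
Proof.
move=> regL [s0 [s1 [s0P s1P cP]]] [s0' [s1' [s0P' s1P' cP']]].
have /choice[alpha0 alpha0P] : forall b, exists theta rho,
    0 < rho /\ s0' b = lscale (polar rho theta) (s0 b).
  move=> b; have [pb nb] := s0P b; have [pb' nb'] := s0P' b.
  by apply: point_ratio => //; rewrite pb pb'.
have /choice[m mP] := edge_winding regL s1P s1P' alpha0P.
apply/esym/coclassP => /=; exists (fun e => (m e)%:~R); apply/funext => s.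
have [t [rho [th [tc tl thP cs]]]] := cP s.
have [t' [rho' [th' [tc' tl' thP' cs']]]] := cP' s.
have [beta bc bP] := section_ratio regL tc tc' tl tl'.
have p2 : 2 * pi != 0 :> R by rewrite mulf_neq0 ?gt_eqF ?pi_gt0.
have face_vertex i k : face i s (vertex R k) = s (vertex R (lift i k)).
  by rewrite -coface_vertex.
have winding i : 2 * pi * (m (face i s))%:~R =
    (th' i (vertex R ord_max) - th' i (vertex R ord0)) -
    (th i (vertex R ord_max) - th i (vertex R ord0)) +
    (beta (vertex R (lift i ord_max)) - beta (vertex R (lift i ord0))) -
    (alpha0 (s (vertex R (lift i ord_max))) -
     alpha0 (s (vertex R (lift i ord0)))).
  have [alpha [ac aP] ->] := mP (face i s).
  rewrite !face_vertex; congr (_ - _).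
  have [thc thE] := thP i; have [thc' thE'] := thP' i.
  pose d x := (th' i x + beta (coface i x)) - (alpha x + th i x).
  have dE : forall x y, d x = d y.
    have bcc := comp_cts bc (@coface_cts R _ i).
    apply: simplex_int_valued.
      exact: (fun_subr_cts (fun_addr_cts thc' bcc) (fun_addr_cts ac thc)).
    move=> x; have [r0 e] := thE x; have [r0' e'] := thE' x.
    have [r1 r10 e1] := aP x; have [r2 r20 e2] := bP (coface i x).
    apply: (@angle_diff _ _ regL (rho' i x * r2) _ (r1 * rho i x) _
      (t (coface i x))).
    - exact: (tl _).2.
    - exact: mulr_gt0.
    - exact: mulr_gt0.
    - by rewrite -!polarM -!(scaleA regL) -e -e1 e' e2.
  have := dE (vertex R ord_max) (vertex R ord0); rewrite /d !coface_vertex => e.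
  by lra.
apply: (@fmorph_inj _ _ (@ratr R)); apply: (mulfI p2).
transitivity (2 * pi * (ratr (\val c' s) - ratr (\val c s)) : R).
  by rewrite -rmorphB.
rewrite mulrBr cs cs' /cobound rmorph_sum mulr_sumr -sumrB.
rewrite [RHS](eq_bigr (fun i : 'I_3 =>
  (-1) ^+ i * (2 * pi * (m (face i s))%:~R))); last first.
  by move=> i _; rewrite rmorphM rmorphXn rmorphN1 /= ratr_int mulrCA.
apply/eqP; rewrite -subr_eq0 -sumrB; apply/eqP.
pose del (f : 'I_3 -> R) (i : 'I_3) : R :=
  (-1) ^+ i * (f (lift i (ord_max : 'I_2)) - f (lift i ord0)).
transitivity (\sum_(i < 3) del (fun k => alpha0 (s (vertex R k))) i -
              \sum_(i < 3) del (fun k => beta (vertex R k)) i).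
  by rewrite -sumrB; apply: eq_bigr => i _; rewrite winding /del; ring.
by rewrite !boundary_sum subr0.
Qed.

End Lines.

(** * Pullbacks of lines and naturality of the Chern class *)

Section PullbackSquare.
Variable R : realType.

(** [F] exhibits [L] as the pullback of [L'] along [mu]: [phi b y] is the vector
    of [L] over [b] corresponding to the vector [y] of [L'] over [mu b].  Its
    values on incompatible pairs are junk, whence continuity is only asked
    along families of compatible pairs, rather than on a fibre product. *)
Record pullback_square (B B' : topologicalType) (L : cline R B) (L' : cline R B')
    (mu : B -> B') (F : L -> L') (phi : B -> L' -> L) : Prop := {
  sq_proj : forall x, lproj L' (F x) = mu (lproj L x);
  sq_scale : forall a x, F (lscale a x) = lscale a (F x);
  sq_liftP : forall b y, lproj L' y = mu b ->
    lproj L (phi b y) = b /\ F (phi b y) = y;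
  sq_liftK : forall x, phi (lproj L x) (F x) = x;
  sq_cts : continuous F;
  sq_lift_cts : forall (Z : topologicalType) (f : Z -> B) (s : Z -> L'),
    continuous f -> continuous s -> (forall z, lproj L' (s z) = mu (f z)) ->
    continuous (fun z => phi (f z) (s z))
}.

Section Square.
Variables (B B' : topologicalType) (L : cline R B) (L' : cline R B').
Variables (mu : continuousType B B') (F : L -> L') (phi : B -> L' -> L).
Hypothesis sq : pullback_square mu F phi.

Lemma sq_inj (x y : L) : lproj L x = lproj L y -> F x = F y -> x = y.
Proof. by move=> xy e; rewrite -(sq_liftK sq x) xy e (sq_liftK sq). Qed.

Lemma sq_nonzero (x : L) : nonzero (F x) <-> nonzero x.
Proof.
split=> nx e; apply: nx; first by rewrite -(sq_scale sq) e.
apply: sq_inj; first exact: lscale_proj.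
by rewrite (sq_scale sq).
Qed.

Lemma sq_nonzero_lift (Z : Type) (f : Z -> B) (s : Z -> L') :
  nonzero_lift (fun z => mu (f z)) s -> nonzero_lift f (fun z => phi (f z) (s z)).
Proof.
move=> sf z; have [pz nz] := sf z; have [-> e] := sq_liftP sq pz; split=> //.
by apply/sq_nonzero; rewrite e.
Qed.

Lemma sq_lift_scale a b (y : L') : lproj L' y = mu b ->
  phi b (lscale a y) = lscale a (phi b y).
Proof.
move=> yb; have [e1 e2] := sq_liftP sq yb.
have [e3 e4] : lproj L (phi b (lscale a y)) = b /\
    F (phi b (lscale a y)) = lscale a y.
  by apply: (sq_liftP sq); rewrite ?lscale_proj.
by apply: sq_inj; rewrite ?lscale_proj ?e3 ?e4 ?(sq_scale sq) ?e2.
Qed.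

(** Lift through [phi] the sections that [c] is built from; scalars pass through
    the lift, so all winding numbers are unchanged. *)
Lemma is_chern_cocycle_pull (c : cocycle R B' 2) :
  is_chern_cocycle L' c -> is_chern_cocycle L (pull_cocycle mu c).
Proof.
move=> [s0 [s1 [s0P s1P cP]]].
exists (fun b => phi b (s0 (mu b))).
exists (fun (e : sing R B 1) x => phi (e x) (s1 (push_sing mu e) x)); split.
- by apply: (@sq_nonzero_lift _ id) => b; exact: s0P.
- move=> e; have [sc sl sv] := s1P (push_sing mu e); split.
  + by apply: (sq_lift_cts sq) => [| |x] //; [exact: cts_fun|exact: (sl x).1].
  + exact: sq_nonzero_lift.
  + by move=> i; rewrite sv.
- move=> s; have [t [rho [th [tc tl thP cs]]]] := cP (push_sing mu s).
  exists (fun x => phi (s x) (t x)), rho, th; split.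
  + by apply: (sq_lift_cts sq) => [| |x] //; [exact: cts_fun|exact: (tl x).1].
  + exact: sq_nonzero_lift.
  + move=> i; have [thc thE] := thP i; split=> // x; have [r0 e] := thE x.
    split=> //; rewrite -sq_lift_scale -?e; last exact: (tl (coface i x)).1.
    congr (phi _ (s1 _ _)); exact/continuousEP.
  + exact: cs.
Qed.

Lemma regular_line_pull : regular_line L' -> regular_line L.
Proof.
move=> regL; split.
- move=> a b x; apply: sq_inj; first by rewrite !lscale_proj.
  by rewrite !(sq_scale sq) (scaleA regL).
- move=> a b x /sq_nonzero x0 /(congr1 F); rewrite !(sq_scale sq).
  exact: scale_inj.
- move=> Z f s s' sc sc' sf sf'.
  have lift (u : Z -> L) : nonzero_lift f u ->
      nonzero_lift (fun z => mu (f z)) (fun z => F (u z)).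
    move=> uf z; have [pz nz] := uf z; rewrite (sq_proj sq) pz; split=> //.
    exact/sq_nonzero.
  have Fc := sq_cts sq.
  have [lam lamc lamE] :=
    scale_div regL (comp_cts Fc sc) (comp_cts Fc sc') (lift _ sf) (lift _ sf').
  exists lam => // z; have [l0 e] := lamE z; split=> //.
  apply: sq_inj; first by rewrite lscale_proj (sf z).1 (sf' z).1.
  by rewrite (sq_scale sq).
Qed.

End Square.

(** If [L] is the pullback of [L'] along a retraction [mu] with section [nu],
    then [L'] is the pullback of [L] along [nu], because [mu] after [nu] is the
    identity. *)
Lemma section_square (B B' : topologicalType) (L : cline R B) (L' : cline R B')
    (mu : continuousType B B') F phi (nu : continuousType B' B) :
  @pullback_square B B' L L' mu F phi -> cancel nu mu ->
  @pullback_square B' B L' L nu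
    (fun y => phi (nu (lproj L' y)) y) (fun _ y => F y).
Proof.
move=> sq nuK.
have liftP (y : L') := sq_liftP sq (esym (nuK (lproj L' y))).
split=> //.
- by move=> y; have [] := liftP y.
- by move=> a y; rewrite lscale_proj (sq_lift_scale sq)// nuK.
- move=> b y yb; have Fy : lproj L' (F y) = b by rewrite (sq_proj sq) yb.
  by split=> //; rewrite Fy -yb (sq_liftK sq).
- by move=> y; have [] := liftP y.
- apply: (sq_lift_cts sq) => [| |y]; last by rewrite nuK.
    by apply: comp_cts; exact: cts_fun.
  exact: id_cts.
- by move=> Z f s _ sc _; exact: (comp_cts (sq_cts sq) sc).
Qed.

(** Naturality of [c1] along a retraction.  Cocycles pull back in both
    directions, so either both lines have obstruction cocycles, and then the
    pulled back one is cohomologous to the chosen one, or neither has, and then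
    both classes are 0 by definition of [c1]. *)
Lemma c1_pullback (B B' : topologicalType) (L : cline R B) (L' : cline R B')
    (mu : continuousType B B') F phi (nu : continuousType B' B) :
  @pullback_square B B' L L' mu F phi -> cancel nu mu ->
  regular_line L' -> c1 L = pullback mu (c1 L').
Proof.
move=> sq nuK regL'; have regL := regular_line_pull sq regL'.
rewrite /c1 pullbackE.
have [[c cP]|no] := pselect (exists c, is_chern_cocycle L' c).
  have P' := xgetPex 0 (ex_intro _ c cP).
  have pullP := is_chern_cocycle_pull sq P'.
  have P := xgetPex 0 (ex_intro _ _ pullP).
  exact: chern_cocycle_unique regL P pullP.
have no' (c : cocycle R B 2) : ~ is_chern_cocycle L c.
  move=> /(is_chern_cocycle_pull (section_square sq nuK)) cP.
  by apply: no; exists (pull_cocycle nu c).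
rewrite !xgetPN//; last by move=> c cP; apply: no; exists c.
by congr coclass; apply: val_inj.
Qed.

End PullbackSquare.

(** * Translation in principal bundles and associated lines *)

Section Principal.
Variable H : topGroupType.

(** The local form of a free action whose translation function
    [(x, x t) |-> t] is continuous on the diagonal.  Unlike local triviality, it
    passes at once to the action of a subgroup. *)
Record free_proper (X : rspace H) : Prop := {
  act_free : forall (x : X) t, ract x t = x -> t = 1%g;
  act_small : forall (x : X) (V : set H), nbhs 1%g V ->
    exists2 A, nbhs x A & forall y t, A y -> A (ract y t) -> V t
}.

(** In a local trivialization with fibre coordinate [theta] the translation
    element is [theta x ^-1 * theta (x t)]. *)
Lemma principal_free_proper (X : rspace H) : principal_bundle X -> free_proper X.
Proof.
move=> prX; split.
  move=> x t xt; have [U [th [h [[_ Ux] _ _ thP _]]]] := prX (orb_pi x).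
  have [] := thP x t Ux; rewrite xt => e _.
  by apply: (mulgI (th x)); rewrite mulg1 -e.
move=> x V V1; have [U [th [h [[oU Ux] thc _ thP _]]]] := prX (orb_pi x).
have oU' : open (@orb_pi H X @^-1` U).
  by apply: open_comp => // y _; exact: orb_pi_cts.
have thx : {for x, continuous th}.
  by move: thc; rewrite continuous_open_subspace// => /(_ x); apply; rewrite inE.
have div_cts : continuous (fun p : H * H => (p.1^-1 * p.2)%g).
  apply: (comp_cts (@mulg_cts H) (f := fun p : H * H => (p.1^-1, p.2)%g)).
  apply: pair_cts; last exact: snd_cts.
  by apply: comp_cts; [exact: invg_cts|exact: fst_cts].
have : nbhs (th x, th x) [set p : H * H | V (p.1^-1 * p.2)%g].
  by apply: (div_cts (th x, th x)); rewrite /= mulVg.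
case=> -[P Q] /= [nP nQ] PQ.
exists (@orb_pi H X @^-1` U `&` (th @^-1` P `&` th @^-1` Q)).
  apply: filterI; first exact: open_nbhs_nbhs.
  by apply: filterI; exact: thx.
move=> y t [Uy [Py _]] [_ [_ Qyt]].
have := PQ (th y, th (ract y t)) (conj Py Qyt) => /=.
by rewrite (thP y t Uy).1 mulKg.
Qed.

End Principal.

Lemma restrict_free_proper (G : topGroupType) (T : subgroup G) (X : rspace G) :
  free_proper X -> free_proper (Defs.restrict T X).
Proof.
move=> fX; split=> [x t xt|x V].
  by apply: val_inj; rewrite sg_val1; exact: (act_free fX xt).
move=> V1; have [V' [[W oW WV'] V'1] V'V] :
    exists2 V', open_nbhs (1%g : T) V' & V' `<=` V by move: V1; rewrite nbhsE.
have [|A nA AP] := act_small fX x (V := W).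
  apply: open_nbhs_nbhs; split=> //.
  by have : (\val @^-1` W) (1%g : T) by rewrite WV'.
exists A; first exact: nA.
move=> y t Ay Ayt; apply: V'V; rewrite -WV'; exact: (AP y).
Qed.

Lemma orb_pi_nbhs (H : topGroupType) (X : rspace H) (x : X) (U : set X) :
  nbhs x U -> nbhs (orb_pi x) (@orb_pi H X @` U).
Proof.
rewrite nbhsE => -[V [oV Vx] VU]; apply: filterS (_ : (@orb_pi H X @` V) `<=` _) _.
  exact: image_subset.
by apply: open_nbhs_nbhs; split; [exact: orb_pi_open|exists x].
Qed.

Section AssociatedLine.
Variables (R : realType) (H : topGroupType) (X : rspace H) (gamma : character R H).
Local Notation E := (assoc_line X gamma).
Local Notation pt x v := (@bal H X (rep gamma) x v : ltot E).

Lemma lproj_bal x v : lproj E (pt x v) = orb_pi x.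
Proof. exact: bal_projE. Qed.

Lemma lscale_bal a x v : lscale a (pt x v) = pt x (a * v).
Proof. exact: assoc_scaleE. Qed.

Lemma bal_translate x t v : pt (ract x t) v = pt x (gamma t * v).
Proof. exact: bal_act. Qed.

Lemma assoc_fibre x (y : E) : lproj E y = orb_pi x -> exists v, y = pt x v.
Proof.
have [x' [v ->]] := @bal_surj H X (rep gamma) y.
rewrite lproj_bal => /esym/orb_piP[t ->]; exists (gamma t * v).
exact: bal_translate.
Qed.

Hypothesis fX : free_proper X.

Lemma bal_inj x v v' : pt x v = pt x v' -> v = v'.
Proof.
move=> /orb_piP[t] /= [/esym xt ->]; rewrite (act_free fX xt) invg1.
by rewrite -[LHS](@lact1 _ (rep gamma)).
Qed.

Lemma nonzero_bal x v : nonzero (pt x v) <-> v != 0.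
Proof.
rewrite /nonzero lscale_bal mul0r; split=> [nx|/eqP v0 /bal_inj/esym//].
by apply/eqP => v0; apply: nx; rewrite v0.
Qed.

(** The fibre coordinate [v] of [[x, v]] is a continuous function of the pair
    [(x, [x, v])]: if [[x, v] = [x', v']] with [x] and [x'] close to [x0], then
    [x' = x t] with [t] close to 1, and [v = gamma t * v']. *)
Lemma assoc_coordinate x0 v0 (N : set (cplx R)) : nbhs v0 N ->
  exists A O, [/\ nbhs x0 A, nbhs (pt x0 v0) O &
    forall x v, A x -> O (pt x v) -> N v].
Proof.
move=> nN.
have : nbhs ((1%g : H), v0) [set p : H * cplx R | N (gamma p.1 * p.2)].
  have := @lact_cts _ (rep gamma) (1%g, v0); rewrite /= => c.
  apply: (c N); have -> : gamma 1%g * v0 = v0 by exact: (@lact1 _ (rep gamma)).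
  exact: nN.
case=> -[P Q] /= [nP nQ] PQ.
have [A nA AP] := act_small fX x0 nP.
exists A, (@orb_pi H (prod_rspace X (rep gamma)) @` (A `*` Q)); split=> //.
  apply: orb_pi_nbhs; exists (A, Q) => //.
move=> x v Ax [[x' v'] /= [Ax' Qv']] /esym/orb_piP[t] /= [ex ev].
have -> : v = gamma t * v'.
  rewrite ev mulrA -charM mulgV.
  by rewrite -[LHS](@lact1 _ (rep gamma)).
apply: (PQ (t, v')); split=> //=; apply: (AP x) => //.
by rewrite -ex.
Qed.

(** Near [z0] both sections are written over a common [x]; their ratio is the
    ratio of their fibre coordinates, continuous by [assoc_coordinate]. *)
Lemma assoc_regular : regular_line E.
Proof.
split.
- move=> a b y; have [x [v ->]] := @bal_surj H X (rep gamma) y.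
  by rewrite !lscale_bal mulrA.
- move=> a b y; have [x [v ->]] := @bal_surj H X (rep gamma) y.
  by move=> /nonzero_bal v0; rewrite !lscale_bal => /bal_inj /(mulIf v0).
move=> Z f s s' sc sc' sf sf'.
have /choice[lam lamE] : forall z, exists a : cplx R,
    a != 0 /\ s' z = lscale a (s z).
  move=> z; have [pz] := sf z; have [pz'] := sf' z.
  have [x [v e]] := @bal_surj H X (rep gamma) (s z).
  have [v' e'] : exists v', s' z = pt x v'.
    by apply: assoc_fibre; rewrite pz' -pz e lproj_bal.
  rewrite e e' => /nonzero_bal v0' /nonzero_bal v0; exists (v' / v).
  by rewrite mulf_neq0 ?invr_eq0// lscale_bal divfK.
exists lam => // z0 W nW.
have [l0 e'] := lamE z0; have [x0 [v0 e]] := @bal_surj H X (rep gamma) (s z0).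
have v0n : v0 != 0 by apply/(nonzero_bal x0); have := (sf z0).2; rewrite e.
rewrite e lscale_bal in e'.
have : nbhs (v0, lam z0 * v0) [set p : cplx R * cplx R | W (p.2 / p.1)].
  have : (fun p : cplx R * cplx R => p.2 / p.1) @ (v0, lam z0 * v0) -->
      (lam z0 * v0) / v0.
    apply: (@cvgM R[i]); first exact: cvg_snd.
    by apply: (@cvgV R[i]) => //; exact: cvg_fst.
  by apply; rewrite mulfK.
case=> -[N1 N2] /= [nN nN'] NN.
have [A [U [nA nU AU]]] := assoc_coordinate x0 nN.
have [A' [U' [nA' nU' AU']]] := assoc_coordinate x0 nN'.
have nAA : nbhs (s z0)
    (@orb_pi H (prod_rspace X (rep gamma)) @` ((A `&` A') `*` setT)).
  rewrite e; apply: orb_pi_nbhs; exists (A `&` A', setT) => //=; split.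
    exact: filterI.
  exact: filterT.
have nUs : nbhs (s z0) U by rewrite e.
have nUs' : nbhs (s' z0) U' by rewrite e'.
have hA : nbhs z0 (s @^-1` _) := sc z0 _ nAA.
have hU : nbhs z0 (s @^-1` U) := sc z0 _ nUs.
have hU' : nbhs z0 (s' @^-1` U') := sc' z0 _ nUs'.
change (nbhs z0 (lam @^-1` W)).
apply: filterS (filterI hA (filterI hU hU')) => z /=.
move=> [[[x v] [[/= Ax A'x] _] ez] [Uz Uz']].
have ez1 : s z = pt x v by rewrite -ez.
have [l0z e1] := lamE z; rewrite ez1 lscale_bal in e1.
have vn : v != 0 by apply/(nonzero_bal x); have := (sf z).2; rewrite ez1.
have -> : lam z = (lam z * v) / v by rewrite mulfK.
apply: (NN (v, lam z * v)); split=> /=.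
  by apply: (AU x) => //; rewrite -ez1.
by apply: (AU' x) => //; rewrite -e1.
Qed.

End AssociatedLine.

(** * The equivariant line as a pullback *)

Section FlagBundle.
Variables (R : realType) (G : topGroupType) (T : subgroup G) (EG : rspace G).
Variable gamma : character R T.
Local Notation ET := (Defs.restrict T EG).
Local Notation BT := (classifying T EG).
Local Notation FT := (borel EG (flag T)).

Let mul (p : prod_rspace ET (flag T)) : BT :=
  orb_pi (ract (p.1 : EG) (repr p.2) : ET).

Let mulE e g : mul (e, coset T g) = orb_pi (ract (e : EG) g : ET).
Proof.
rewrite /mul /=; have [t ->] := @orb_repr T (GoverT T) g.
by rewrite /= ractM; exact: orb_pi_act.
Qed.

Let mul_cts : continuous mul.
Proof.
apply: (@prod_orb_cts T (GoverT T)).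
under eq_fun do rewrite -/(coset T _) mulE.
exact: (comp_cts (@orb_pi_cts T ET) (@ract_cts G EG)).
Qed.

Let mul_act p t : mul (ract p t) = mul p.
Proof.
case: p => e c; have [g ->] : exists g, c = coset T g.
  by exists (repr c); rewrite /coset orb_reprK.
change (mul (ract e t, lact (t^-1)%g (coset T g)) = mul (e, coset T g)).
rewrite lact_coset !mulE; congr orb_pi.
by rewrite [LHS](esym (@ractM G EG e _ _)) mulgA sg_valV mulgV mul1g.
Qed.

(** The map [[e, g T] |-> [e g]] from the Borel construction of [G / T] to
    [BT]. *)
Definition borel_mul : continuousType FT BT := orb_lift mul_cts mul_act.

Lemma borel_mulE (e : ET) g :
  borel_mul (@bal T ET (flag T) e (coset T g)) = orb_pi (ract (e : EG) g : ET).
Proof. by rewrite -mulE; exact: (orb_liftE mul_act). Qed.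

Local Notation LT := (LlineT EG gamma).
Local Notation S := (Sline EG gamma).
Local Notation br g v := (@bal T (GoverT T) (rep gamma) g v : Ltot gamma).
Local Notation pt e g v := (@bal T ET (Ltot gamma) e (br g v) : ltot LT).

Lemma LlineT_surj (y : LT) : exists e g v, y = pt e g v.
Proof.
have [e [x ->]] := @bal_surj T ET (Ltot gamma) y.
have [g [v ->]] := @bal_surj T (GoverT T) (rep gamma) x.
by exists e, g, v.
Qed.

Lemma lproj_LlineT e g v : lproj LT (pt e g v) = @bal T ET (flag T) e (coset T g).
Proof.
apply: etrans (bal_mapE _ _ e _) _; congr bal; exact: lproj_bal.
Qed.

Lemma lscale_LlineT a e g v : lscale a (pt e g v) = pt e g (a * v).
Proof.
apply: etrans (bal_mapE _ _ e _) _; congr bal; exact: lscale_bal.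
Qed.

Lemma LlineT_fibre e g (y : LT) : lproj LT y = @bal T ET (flag T) e (coset T g) ->
  exists v, y = pt e g v.
Proof.
have [e' [g' [v' ->]]] := LlineT_surj y; rewrite lproj_LlineT.
move=> /orb_piP[t] [-> e1].
have {}e1 : coset T g = lact (t^-1)%g (coset T g') := e1.
have [v ev] : exists v, br ((\val t)^-1 * g')%g v' = br g v.
  apply: (@assoc_fibre R T (GoverT T) gamma); rewrite lproj_bal.
  by rewrite -/(coset T _) -/(coset T g) e1 lact_coset.
exists v; rewrite -ev.
rewrite [RHS](@bal_act T ET (Ltot gamma)) lact_Ltot.
by rewrite mulgA mulgV mul1g.
Qed.

Let mulL (p : prod_rspace ET (Ltot gamma)) : S :=
  let q := repr (p.2 : orb (prod_rspace (GoverT T) (rep gamma))) in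
  @bal T ET (rep gamma) (ract (p.1 : EG) q.1) q.2.

Let mulLE e g v : mulL (e, br g v) = @bal T ET (rep gamma) (ract (e : EG) g) v.
Proof.
rewrite /mulL /=.
have [t ->] := @orb_repr T (prod_rspace (GoverT T) (rep gamma)) (g, v).
apply/esym/orb_piP; exists t; congr pair; exact: (@ractM G EG).
Qed.

Let mulL_cts : continuous mulL.
Proof.
apply: (@prod_orb_cts T (prod_rspace (GoverT T) (rep gamma))).
have -> : (fun p : ET * prod_rspace (GoverT T) (rep gamma) =>
      mulL (p.1, orb_pi p.2)) =
    (fun p => @bal T ET (rep gamma) (ract (p.1 : EG) p.2.1) p.2.2).
  by apply/funext => -[e [g v]]; exact: mulLE.
apply: (comp_cts (@orb_pi_cts T (prod_rspace ET (rep gamma)))).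
have c2 : continuous (fun q : ET * prod_rspace (GoverT T) (rep gamma) => q.2).
  exact: snd_cts.
apply: pair_cts; last exact: (comp_cts (@snd_cts _ _) c2).
apply: (comp_cts (@ract_cts G EG)
  (f := fun q : ET * prod_rspace (GoverT T) (rep gamma) =>
          (q.1 : EG, q.2.1 : G))).
by apply: pair_cts; [exact: fst_cts|exact: (comp_cts (@fst_cts _ _) c2)].
Qed.

Let mulL_act p t : mulL (ract p t) = mulL p.
Proof.
case: p => e x; have [g [v ->]] := @bal_surj T (GoverT T) (rep gamma) x.
change (mulL (ract e t, lact (t^-1)%g (br g v)) = mulL (e, br g v)).
rewrite lact_Ltot !mulLE; congr bal.
by rewrite [LHS](esym (@ractM G EG e _ _)) mulgA sg_valV mulgV mul1g.
Qed.

(** The bundle map [[e, [g, v]] |-> [e g, v]] covering [borel_mul]. *)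
Definition line_mul : LT -> S := orb_lift mulL_cts mulL_act.

Lemma line_mulE e g v :
  line_mul (pt e g v) = @bal T ET (rep gamma) (ract (e : EG) g) v.
Proof. by rewrite -mulLE; exact: (orb_liftE mulL_act). Qed.

Hypothesis fE : free_proper EG.
Let fET : free_proper ET := restrict_free_proper T fE.

Lemma line_mul_inj (x y : LT) : lproj LT x = lproj LT y ->
  line_mul x = line_mul y -> x = y.
Proof.
have [e [g [v ->]]] := LlineT_surj x.
rewrite lproj_LlineT => /esym/LlineT_fibre[v' ->]; rewrite !line_mulE.
by move/(bal_inj fET) => ->.
Qed.

Lemma pt_cts : continuous (fun p : ET * (G * cplx R) => pt p.1 p.2.1 p.2.2).
Proof.
apply: (comp_cts (@orb_pi_cts T (prod_rspace ET (Ltot gamma)))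
  (f := fun p : ET * (G * cplx R) => (p.1, br p.2.1 p.2.2))).
apply: pair_cts; first exact: fst_cts.
apply: (comp_cts (@orb_pi_cts T (prod_rspace (GoverT T) (rep gamma)))
  (f := fun p : ET * (G * cplx R) => (p.2.1, p.2.2))).
have c2 : continuous (fun p : ET * (G * cplx R) => p.2) by exact: snd_cts.
by apply: pair_cts; apply: (comp_cts _ c2); [exact: fst_cts|exact: snd_cts].
Qed.

(** The equivariant line over the Borel construction is the pullback of the
    associated line on [BT] along [borel_mul]: over [[e, g T]] the vector
    [[e g, v]] comes from [[e, [g, v]]] alone.  The lift is continuous because
    [e] and [g] can be chosen locally near given ones, [borel_mul] being defined
    on a quotient by open maps, and [v] then depends continuously on [e g] and
    [[e g, v]], by [assoc_coordinate]. *)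
Lemma LlineT_square :
  exists phi, @pullback_square R FT BT LT S borel_mul line_mul phi.
Proof.
have /choice[phi0 phiP] : forall q : FT * S, exists x : LT,
    lproj S q.2 = borel_mul q.1 -> lproj LT x = q.1 /\ line_mul x = q.2.
  move=> [b y] /=; have [e [c be]] := @bal_surj T ET (flag T) b.
  have [g ce] : exists g, c = coset T g.
    by exists (repr c); rewrite /coset orb_reprK.
  rewrite be ce borel_mulE.
  have [/assoc_fibre[v ->]|no] :=
    pselect (lproj S y = orb_pi (ract (e : EG) g : ET)).
    by exists (pt e g v); rewrite lproj_LlineT line_mulE.
  (* An arbitrary value on incompatible pairs. *)
  by exists (pt e g 0).
exists (fun b y => phi0 (b, y)).
have proj_mul x : lproj S (line_mul x) = borel_mul (lproj LT x).
  have [e [g [v ->]]] := LlineT_surj x.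
  by rewrite lproj_LlineT line_mulE borel_mulE lproj_bal.
split=> //.
- move=> a x; have [e [g [v ->]]] := LlineT_surj x.
  by rewrite lscale_LlineT !line_mulE lscale_bal.
- by move=> b y; exact: (phiP (b, y)).
- move=> x; have [p1 p2] := phiP (lproj LT x, line_mul x) (proj_mul x).
  exact: line_mul_inj.
- exact: cts_fun.
move=> Z f s fc sc sf z0 W nW.
have [e0 [c0 f0]] := @bal_surj T ET (flag T) (f z0).
have [g0 c0E] : exists g, c0 = coset T g.
  by exists (repr c0); rewrite /coset orb_reprK.
rewrite c0E in f0.
have lift z e g : f z = @bal T ET (flag T) e (coset T g) ->
    exists v, s z = @bal T ET (rep gamma) (ract (e : EG) g) v /\
      phi0 (f z, s z) = pt e g v.
  move=> fz.
  have [v sv] : exists v, s z = @bal T ET (rep gamma) (ract (e : EG) g) v.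
    by apply: (@assoc_fibre R T ET gamma); rewrite sf fz borel_mulE.
  exists v; split=> //; have [p1 p2] := phiP (f z, s z) (sf z).
  apply: line_mul_inj; first by rewrite p1 lproj_LlineT /= fz.
  by rewrite p2 line_mulE -sv.
have [v0 [s0 p0]] := lift z0 e0 g0 f0.
rewrite p0 in nW.
have := @pt_cts (e0, (g0, v0)) W nW.
case=> -[NE NGV] /= [nE [[NG NV] /= [nG nV] GV]] EGV.
have [A [U [nA nU AU]]] :=
  @assoc_coordinate R T ET gamma fET (ract (e0 : EG) g0) _ _ nV.
have [[NE' NG'] /= [nE' nG'] EGA] := @ract_cts G EG (e0, g0) A nA.
pose im := @orb_pi T (prod_rspace ET (flag T)) @`
  ((NE `&` NE') `*` (@orb_pi T (GoverT T) @` (NG `&` NG'))).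
have nim : nbhs (f z0) im.
  rewrite f0; apply: orb_pi_nbhs.
  exists (NE `&` NE', @orb_pi T (GoverT T) @` (NG `&` NG')) => //=; split.
    exact: filterI.
  by apply: orb_pi_nbhs; exact: filterI.
have hf : nbhs z0 (f @^-1` im) := fc z0 _ nim.
have hs : nbhs z0 (s @^-1` U) by apply: sc; rewrite s0.
change (nbhs z0 ((fun z => phi0 (f z, s z)) @^-1` W)).
apply: filterS (filterI hf hs) => z.
move=> [[[e c] [/= [Ee E'e] [g [Gg G'g] gc]] ez] Uz].
have [v [sv pv]] : exists v, s z = @bal T ET (rep gamma) (ract (e : EG) g) v /\
      phi0 (f z, s z) = pt e g v.
  by apply: lift; rewrite -ez -gc.
rewrite /= pv; apply: (EGV (e, (g, v))); split=> //=; apply: (GV (g, v)).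
split=> //=; apply: (AU (ract (e : EG) g)); first exact: (EGA (e, g)).
by move: Uz; rewrite /= sv.
Qed.

End FlagBundle.

(** * Restriction to the fixed points *)

Section FlagSection.
Variables (R : realType) (G : topGroupType) (T : subgroup G) (EG : rspace G).
Local Notation ET := (Defs.restrict T EG).

Let sec (e : ET) : prod_rspace ET (flag T) := (e, coset T 1%g).

Let sec_cts : continuous sec.
Proof. by apply: pair_cts; [exact: id_cts|exact: cst_cts]. Qed.

Let sec_act e t : sec (ract e t) = ract (sec e) t.
Proof.
change (sec (ract e t) = (ract e t, lact (t^-1)%g (coset T 1%g))).
rewrite lact_coset mulg1 /sec; congr pair.
by apply/cosetP; exists (t^-1)%g; rewrite mul1g.
Qed.

(** The section [[e] |-> [e, T]] of [borel_mul]; it is well defined because [T]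
    fixes the coset [T]. *)
Definition borel_unit : continuousType (classifying T EG) (borel EG (flag T)) :=
  orb_map sec_cts sec_act.

Lemma borel_unitK : cancel borel_unit (borel_mul T EG).
Proof.
move=> b; rewrite -(orb_reprK b) [borel_unit _](orb_mapE sec_cts sec_act).
by rewrite [LHS]borel_mulE /= ract1.
Qed.

Lemma c1T_pullback (gamma : character R T) : principal_bundle EG ->
  c1T EG gamma = pullback (borel_mul T EG) (c1 (Sline EG gamma)).
Proof.
move=> /principal_free_proper fE; have [phi sq] := LlineT_square gamma fE.
apply: c1_pullback sq borel_unitK _.
exact: (assoc_regular gamma (restrict_free_proper T fE)).
Qed.

(** For [w = n T], restriction to the fixed point followed by multiplication is
    [[e] |-> [e, n T] |-> [e n]], the right translation by [w]. *)
Lemma borel_mul_weyl (w : weyl T) b :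
  borel_mul T EG (borel_incl EG w (borel_pt EG w b)) = weyl_trans EG w b.
Proof.
rewrite -(orb_reprK b) borel_ptE [borel_incl _ _ _]bal_mapE /=.
have [n _ wn] := set_valP w.
by rewrite (@weyl_transE G T EG w n (repr b) wn) -wn [LHS]borel_mulE.
Qed.

End FlagSection.

Theorem proposition10
    (R : realType) (G : topGroupType)
    (lieG : lie_group R G)
    (compactG : compact [set: G]) (connectedG : connected [set: G])
    (T : subgroup G) (maxT : maximal_torus R T)
    (EG : rspace G) (univEG : universal_bundle R EG)
    (l : nat) (chi : 'I_l -> character R T) (basis_chi : character_basis chi)
    (w : weyl T) :
  [/\ forall i : 'I_l,
        restr w (coeff (flag T) (c1 (Sline EG (chi i)))) = c1 (Sline EG (chi i)),
      forall gamma : character R T,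
        restr w (c1T EG gamma) = weyl_act w (c1 (Sline EG gamma)) &
      forall i : 'I_l,
        restr w (c1T EG (chi i)) = weyl_act w (c1 (Sline EG (chi i)))].
Proof.
have part_ii gamma : restr w (c1T EG gamma) = weyl_act w (c1 (Sline EG gamma)).
  rewrite c1T_pullback; last exact: univEG.1.
  have muc := comp_cts (@cts_fun _ _ (borel_mul T EG))
    (@cts_fun _ _ (borel_incl EG w)).
  rewrite /restr (pullback_comp (k := mkcts muc))//.
  by apply: pullback_comp => b; exact: borel_mul_weyl.
split=> // i; rewrite /restr /coeff.
(* Restricting coefficients only sees that all spaces involved lie over [BT]:
   [BT -> {w}_T -> (G/T)_T -> BT] is the identity. *)
rewrite (pullback_comp (k := bal_proj _ (fixpt w))).
  rewrite (pullback_comp (k := mkcts (@id_cts _))); last exact: borel_ptK.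
  by apply: pullback_id.
move=> y; have [e [x ->]] := bal_surj y.
by rewrite [borel_incl _ _ _]bal_mapE !bal_projE.
Qed.
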